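(* Let $\omega$ be a clustering state. There exists a bijection $\widehat{\mathfrak D}:\widehat{\mathcal Q}_\omega\to\widehat{\mathcal H}_\omega$ such that for every $\widehat Q_\omega\in\widehat{\mathcal Q}_\omega$ and every $A\in\mathcal O$, $$\widehat Q_\omega(A)=\langle\langle\widehat{\mathfrak D}(\widehat Q_\omega),A\rangle\rangle_\omega.$$ In particular, every $\widehat Q_\omega$ extends to a continuous linear functional on $\widehat{\mathcal H}_\omega$.
   Context: Setting: Fix $D\ge1$, $\mathbb Z^D$ with $\mathrm{dist}(x,y)=\sum_i|x_i-y_i|$, $\mathtt B(n)=\{x:\mathrm{dist}(x,0)\le n\}$. $\mathcal O$ is a complex normed space with distinguished $\mathbf 1$ of norm 1, finite-dimensional subspaces $\mathcal O_X$ ($X$ finite) with $\mathcal O_\emptyset=\mathbb C\mathbf 1$, $X\subset Y\Rightarrow\mathcal O_X\subset\mathcal O_Y$, $\mathcal O_X\cap\mathcal O_Y=\mathcal O_{X\cap Y}$, $\mathcal O=\bigcup_X\mathcal O_X$; $\mathrm{supp}(A)$ smallest $X$ with $A\in\mathcal O_X$, $|A|=|\mathrm{supp}A|$, $\mathrm{dist}(A,B)$ distance of supports ($\mathrm{dist}(A,\mathbf 1)=\infty$). Completion $\mathcal A$ is a unital $C^*$-algebra, $\mathcal O_X$ are $C^*$-subalgebras, disjointly supported elements commute with union support of the product; translations $\iota_x$ are $*$-automorphisms, $\iota_x\iota_y=\iota_{x+y}$, $\mathrm{supp}(\iota_xA)=\mathrm{supp}(A)+x$. Clustering state: translation-invariant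 state $\omega$ with $\nu:\mathbb N\to\mathbb R^+$, $f:\mathbb Z\to\mathbb R^+$, $p>D$, $f(d)\le d^{-p}$ ($d>0$), $|\omega(AB)-\omega(A)\omega(B)|\le\nu(\ell)\|A\|\|B\|f(\mathrm{dist}(A,B))$ for $|A|,|B|<\ell$. $\langle\langle A,B\rangle\rangle_\omega:=\sum_{x\in\mathbb Z^D}\big(\tfrac12\omega(\{\iota_x(A)^*,B\})-\omega(A^* )\omega(B)\big)$ ($\{\cdot,\cdot\}$ the anticommutator), a positive semi-definite sesquilinear form; $\widehat{\mathcal H}_\omega$ is the Cauchy completion of $\mathcal O$ modulo its null space (elements of $\mathcal O$ identified with classes). Pseudolocal sequence $Q=(Q_n)$, $Q_n\in\mathcal O_{\mathtt B(n)}$: $Q'_n:=Q_n-\omega(Q_n)\mathbf 1$ satisfies (I) $\omega(Q_n'^*Q'_n)\le\gamma n^D$ for some $\gamma>0$, all $n>0$; (II) $\lim_n\omega(Q_n'^*A)$ exists for all $A\in\mathcal O$; (III) for some $0<k<1$, $\lim_n\max_{x,y\in\mathtt B(kn)}|\omega(Q_n'^*\iota_xA)-\omega(Q_n'^*\iota_yA)|=0$ for all $A$. If both $Q$ and $Q^*=(Q_n^* )$ are pseudolocal, the two-sided pseudolocal charge of $Q$ is the functional $\widehat Q_\omega(A):=\lim_{n\to\infty}\big(\tfrac12\omega(\{Q_n^*,A\})-\omega(Q_n^* )\omega(A)\big)$ on $\mathcal O$; $\widehat{\mathcal Q}_\omega$ is the set of all such functionals. *)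

(* Defs.v *)
From Stdlib Require Import Reals ZArith List.
From Coquelicot Require Import Coquelicot.
Import ListNotations.
Open Scope R_scope.

Definition pt (D : nat) (x : list Z) : Prop := length x = D.
Definition zeros (D : nat) : list Z := repeat 0%Z D.
Definition vadd (x y : list Z) : list Z := map (fun p => (fst p + snd p)%Z) (combine x y).
Definition ldist (x y : list Z) : Z :=
  fold_right Z.add 0%Z (map (fun p => Z.abs (fst p - snd p)) (combine x y)).

Definition lset := list Z -> Prop.
Definition sub_l (X Y : lset) : Prop := forall x, X x -> Y x.
Definition inter_l (X Y : lset) : lset := fun x => X x /\ Y x.
Definition empty_l : lset := fun _ => False.
Definition disjoint_l (X Y : lset) : Prop := forall x, X x -> Y x -> False.
Definition shift_l (X : lset) (a : list Z) : lset := fun y => exists z, X z /\ y = vadd z a.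
Definition finite_l (X : lset) : Prop := exists L : list (list Z), forall x, X x <-> In x L.
Definition fin_in (D : nat) (X : lset) : Prop := finite_l X /\ sub_l X (pt D).
Definition ballP (D n : nat) : lset := fun x => pt D x /\ (ldist x (zeros D) <= Z.of_nat n)%Z.
Fixpoint box (d n : nat) : list (list Z) :=
  match d with
  | O => [ [] ]
  | S d' => flat_map (fun z => map (cons z) (box d' n))
              (map (fun k => (Z.of_nat k - Z.of_nat n)%Z) (seq 0 (2 * n + 1)))
  end.
Definition ballL (D n : nat) : list (list Z) :=
  filter (fun x => Z.leb (ldist x (zeros D)) (Z.of_nat n)) (box D n).

Record LatticeSystem (D : nat) := mkLS {
  Obs : Type;                       (* the local algebra O = union of the O_X *)
  oadd : Obs -> Obs -> Obs;
  oscal : C -> Obs -> Obs;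
  omul : Obs -> Obs -> Obs;
  oadj : Obs -> Obs;
  oone : Obs;
  onorm : Obs -> R;
  Oloc : lset -> Obs -> Prop;       (* Oloc X A  <->  A \in O_X  (X finite) *)
  otrans : list Z -> Obs -> Obs
}.
Arguments Obs {D}. Arguments oadd {D l}. Arguments oscal {D l}. Arguments omul {D l}.
Arguments oadj {D l}. Arguments oone {D l}. Arguments onorm {D l}. Arguments Oloc {D l}.
Arguments otrans {D l}.

Section Defs.
Context {D : nat} (S : LatticeSystem D).
Local Notation O := (Obs S).

Definition ozero : O := oscal (RtoC 0) (@oone D S).
Definition osub (a b : O) : O := oadd a (oscal (RtoC (-1)) b).
Definition lincomb (cs : list C) (L : list O) : O :=
  fold_right (fun p acc => oadd (oscal (fst p) (snd p)) acc) ozero (combine cs L).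

Definition IsSupp (A : O) (X : lset) : Prop :=
  fin_in D X /\ (@Oloc D S) X A /\ (forall Y, fin_in D Y -> (@Oloc D S) Y A -> sub_l X Y).
Definition Enum (X : lset) (L : list (list Z)) : Prop :=
  NoDup L /\ forall x, X x <-> In x L.
Definition IsMinDist (X Y : lset) (d : Z) : Prop :=
  (exists x y, X x /\ Y y /\ ldist x y = d) /\
  (forall x y, X x -> Y y -> (d <= ldist x y)%Z).

(** Axioms: O is a complex normed *-algebra whose completion is a unital
    C^*-algebra, with the local structure and translations of the setting. *)
Record LS_axioms : Prop := {
  ax_addA : forall a b c : O, oadd a (oadd b c) = oadd (oadd a b) c;
  ax_addC : forall a b : O, oadd a b = oadd b a;
  ax_add0 : forall a : O, oadd a ozero = a;
  ax_addN : forall a : O, osub a a = ozero;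
  ax_scal1 : forall a : O, oscal (RtoC 1) a = a;
  ax_scalA : forall (c d : C) (a : O), oscal c (oscal d a) = oscal (Cmult c d) a;
  ax_scalDl : forall (c d : C) (a : O), oscal (Cplus c d) a = oadd (oscal c a) (oscal d a);
  ax_scalDr : forall (c : C) (a b : O), oscal c (oadd a b) = oadd (oscal c a) (oscal c b);
  ax_mulA : forall a b c : O, omul a (omul b c) = omul (omul a b) c;
  ax_mul1l : forall a : O, omul (@oone D S) a = a;
  ax_mul1r : forall a : O, omul a (@oone D S) = a;
  ax_mulDl : forall a b c : O, omul (oadd a b) c = oadd (omul a c) (omul b c);
  ax_mulDr : forall a b c : O, omul a (oadd b c) = oadd (omul a b) (omul a c);
  ax_mulZl : forall (c : C) (a b : O), omul (oscal c a) b = oscal c (omul a b);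
  ax_mulZr : forall (c : C) (a b : O), omul a (oscal c b) = oscal c (omul a b);
  ax_adjK : forall a : O, oadj (oadj a) = a;
  ax_adjD : forall a b : O, oadj (oadd a b) = oadd (oadj a) (oadj b);
  ax_adjZ : forall (c : C) (a : O), oadj (oscal c a) = oscal (Cconj c) (oadj a);
  ax_adjM : forall a b : O, oadj (omul a b) = omul (oadj b) (oadj a);
  ax_norm_def : forall a : O, onorm a = 0 -> a = ozero;
  ax_norm_tri : forall a b : O, onorm (oadd a b) <= onorm a + onorm b;
  ax_normZ : forall (c : C) (a : O), onorm (oscal c a) = Cmod c * onorm a;
  ax_normM : forall a b : O, onorm (omul a b) <= onorm a * onorm b;
  ax_normCstar : forall a : O, onorm (omul (oadj a) a) = onorm a * onorm a;
  ax_norm1 : onorm (@oone D S) = 1;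
  ax_loc_add : forall X a b, fin_in D X -> (@Oloc D S) X a -> (@Oloc D S) X b -> (@Oloc D S) X (oadd a b);
  ax_loc_scal : forall X c a, fin_in D X -> (@Oloc D S) X a -> (@Oloc D S) X (oscal c a);
  ax_loc_mul : forall X a b, fin_in D X -> (@Oloc D S) X a -> (@Oloc D S) X b -> (@Oloc D S) X (omul a b);
  ax_loc_adj : forall X a, fin_in D X -> (@Oloc D S) X a -> (@Oloc D S) X (oadj a);
  ax_loc_findim : forall X, fin_in D X ->
      exists L : list O, forall a, (@Oloc D S) X a -> exists cs : list C, a = lincomb cs L;
  ax_loc_empty : forall a, (@Oloc D S) empty_l a <-> exists c : C, a = oscal c (@oone D S);
  ax_loc_mono : forall X Y a, fin_in D X -> fin_in D Y -> sub_l X Y -> (@Oloc D S) X a -> (@Oloc D S) Y a;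
  ax_loc_inter : forall X Y a, fin_in D X -> fin_in D Y -> (@Oloc D S) X a -> (@Oloc D S) Y a ->
      (@Oloc D S) (inter_l X Y) a;
  ax_loc_union : forall a, exists X, fin_in D X /\ (@Oloc D S) X a;
  ax_loc_comm : forall X Y a b, fin_in D X -> fin_in D Y -> disjoint_l X Y ->
      (@Oloc D S) X a -> (@Oloc D S) Y b -> omul a b = omul b a;
  ax_tr_add : forall x a b, pt D x -> (@otrans D S) x (oadd a b) = oadd ((@otrans D S) x a) ((@otrans D S) x b);
  ax_tr_scal : forall x c a, pt D x -> (@otrans D S) x (oscal c a) = oscal c ((@otrans D S) x a);
  ax_tr_mul : forall x a b, pt D x -> (@otrans D S) x (omul a b) = omul ((@otrans D S) x a) ((@otrans D S) x b);
  ax_tr_adj : forall x a, pt D x -> (@otrans D S) x (oadj a) = oadj ((@otrans D S) x a);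
  ax_tr_one : forall x, pt D x -> (@otrans D S) x (@oone D S) = (@oone D S);
  ax_tr_inj : forall x a b, pt D x -> (@otrans D S) x a = (@otrans D S) x b -> a = b;
  ax_tr_surj : forall x a, pt D x -> exists b, (@otrans D S) x b = a;
  ax_tr_norm : forall x a, pt D x -> onorm ((@otrans D S) x a) = onorm a;
  ax_tr_comp : forall x y a, pt D x -> pt D y -> (@otrans D S) x ((@otrans D S) y a) = (@otrans D S) (vadd x y) a;
  ax_tr_supp : forall x a X, pt D x -> IsSupp a X -> IsSupp ((@otrans D S) x a) (shift_l X x)
}.

Variable omega : O -> C.

(** translation-invariant state (restricted to O) *)
Definition IsState : Prop :=
  (forall a b, omega (oadd a b) = Cplus (omega a) (omega b)) /\
  (forall c a, omega (oscal c a) = Cmult c (omega a)) /\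
  omega (@oone D S) = RtoC 1 /\
  (forall a, 0 <= Re (omega (omul (oadj a) a)) /\ Im (omega (omul (oadj a) a)) = 0) /\
  (forall a, Cmod (omega a) <= onorm a) /\
  (forall x a, pt D x -> omega ((@otrans D S) x a) = omega a).

Definition ClusteringState : Prop :=
  IsState /\
  exists (nu : nat -> R) (f : Z -> R) (p : R),
    (forall l, 0 < nu l) /\ (forall d, 0 < f d) /\ INR D < p /\
    (forall d : Z, (0 < d)%Z -> f d <= Rpower (IZR d) (- p)) /\
    (forall (l : nat) (a b : O) X Y LX LY (d : Z),
        IsSupp a X -> IsSupp b Y -> Enum X LX -> Enum Y LY ->
        (length LX < l)%nat -> (length LY < l)%nat -> IsMinDist X Y d ->
        Cmod (Cminus (omega (omul a b)) (Cmult (omega a) (omega b)))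
          <= nu l * onorm a * onorm b * f d).

Definition anticomm (a b : O) : O := oadd (omul a b) (omul b a).
Definition half : C := RtoC (1 / 2).

Definition bra_term (a b : O) (x : list Z) : C :=
  Cminus (Cmult half (omega (anticomm (oadj ((@otrans D S) x a)) b)))
         (Cmult (omega (oadj a)) (omega b)).
Definition bra_partial (a b : O) (n : nat) : C :=
  fold_right Cplus (RtoC 0) (map (bra_term a b) (ballL D n)).
(** << A , B >>_omega = sum over x in Z^D, taken as lim_n of the sums over B(n) *)
Definition bra (a b : O) : C :=
  (real (Lim_seq (fun n => Re (bra_partial a b n))),
   real (Lim_seq (fun n => Im (bra_partial a b n)))).

(** Cauchy completion of O modulo null vectors: Cauchy sequences for the
    seminorm ||A||^2 = << A , A >>, and their equivalence *)
Definition sqn (a : O) : R := Re (bra a a).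
Definition CauchyH (s : nat -> O) : Prop :=
  forall eps, 0 < eps -> exists N, forall m n, (N <= m)%nat -> (N <= n)%nat ->
    sqn (osub (s m) (s n)) < eps.
Definition EquivH (s t : nat -> O) : Prop :=
  forall eps, 0 < eps -> exists N, forall n, (N <= n)%nat -> sqn (osub (s n) (t n)) < eps.

Definition Qp (Q : nat -> O) (n : nat) : O := osub (Q n) (oscal (omega (Q n)) (@oone D S)).
Definition Pseudolocal (Q : nat -> O) : Prop :=
  (forall n, (@Oloc D S) (ballP D n) (Q n)) /\
  (exists gamma, 0 < gamma /\ forall n, (0 < n)%nat ->
      Re (omega (omul (oadj (Qp Q n)) (Qp Q n))) <= gamma * INR n ^ D) /\
  (forall a, exists l : C,
      filterlim (fun n => omega (omul (oadj (Qp Q n)) a)) eventually (locally l)) /\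
  (exists k, 0 < k < 1 /\ forall a eps, 0 < eps -> exists N, forall n, (N <= n)%nat ->
      forall x y, pt D x -> pt D y ->
      IZR (ldist x (zeros D)) <= k * INR n -> IZR (ldist y (zeros D)) <= k * INR n ->
      Cmod (Cminus (omega (omul (oadj (Qp Q n)) ((@otrans D S) x a)))
                   (omega (omul (oadj (Qp Q n)) ((@otrans D S) y a)))) <= eps).

Definition IsCharge (F : O -> C) : Prop :=
  exists Q : nat -> O, Pseudolocal Q /\ Pseudolocal (fun n => oadj (Q n)) /\
    forall a, filterlim
      (fun n => Cminus (Cmult half (omega (anticomm (oadj (Q n)) a)))
                       (Cmult (omega (oadj (Q n))) (omega a)))
      eventually (locally (F a)).

End Defs.

(* Main.v *)
(* A two-sided charge F is the limit of the symmetrised covariances V(Q_n, .). By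
   (III), V(Q_n, A) is close to V(Q_n, A') where A' is the average of the translates
   of A over a box of side ~ n; Cauchy-Schwarz with V(Q_n, Q_n) = O(n^D) and
   V(A', A') ~ <<A, A>> / n^D bounds |F(A)|^2 by a multiple of <<A, A>>, so the Riesz
   argument represents F by a vector of the completion. Conversely, a Cauchy sequence
   s gives the charge of Q_n = sum of the translates of s_(j(n)) over a box of side
   ~ n, with j(n) growing slowly. All limits rest on one estimate: covariances of
   translates are dominated by the weight prod_i (1 + |x_i|)^(-p/D), which is summable
   because p > D. *)

Require Import Defs.
From Stdlib Require Import Reals ZArith List Lia Lra Permutation.
From Stdlib Require Import Classical ClassicalEpsilon FunctionalExtensionality.
From Coquelicot Require Import Coquelicot.
Import ListNotations.
Open Scope R_scope.

(** * Finite sums *)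

(** Pseudolocality is a one-sided condition, while [bra] is symmetrised. Estimates are therefore
    made for the one-sided covariance [cov] and its lattice sum [Lform]; [symform] recovers the
    symmetrised form from a pair and the pair of adjoints, which is where pseudolocality of both Q
    and its adjoint sequence enters. The clustering constant is uncontrolled in the size of the
    supports, so no estimate is uniform along a Cauchy sequence of local elements. Hence the slow
    index j(n): the box must outrun the constants attached to s_j. The weight is a product so that
    its sum over a box is a power of a one-dimensional sum, for which an exponent p/D > 1 suffices.
    The error of a finite lattice sum depends on the summation set only through the weight it
    misses, so boxes, shifted boxes and balls are interchangeable. Positivity of the summed form is
    not visible term by term; it is inherited from the variances of box sums, divided by the volume.
    A charge is recovered from its pairings, which gives injectivity. Surjectivity also needs that a
    Cauchy sequence whose pairings all tend to 0 is null in norm. *)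

Definition csum {T : Type} (c : T -> C) (L : list T) : C :=
  fold_right Cplus (RtoC 0) (map c L).
Definition rsum {T : Type} (h : T -> R) (L : list T) : R :=
  fold_right Rplus 0 (map h L).

Section FiniteSums.
Context {T : Type}.
Implicit Types (L M : list T) (c : T -> C) (h : T -> R).

Lemma csum_app c L M : csum c (L ++ M) = Cplus (csum c L) (csum c M).
Proof.
  unfold csum; induction L as [|x L IH]; simpl; [ring | rewrite IH; ring].
Qed.

Lemma rsum_app h L M : rsum h (L ++ M) = rsum h L + rsum h M.
Proof.
  unfold rsum; induction L as [|x L IH]; simpl; [ring | rewrite IH; ring].
Qed.

Lemma csum_perm c L M : Permutation L M -> csum c L = csum c M.
Proof.
  unfold csum; induction 1; simpl; try congruence; ring.
Qed.

Lemma rsum_perm h L M : Permutation L M -> rsum h L = rsum h M.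
Proof.
  unfold rsum; induction 1; simpl; try congruence; ring.
Qed.

Lemma csum_ext c c' L : (forall x, In x L -> c x = c' x) -> csum c L = csum c' L.
Proof.
  unfold csum; induction L as [|x L IH]; simpl; intros H; [reflexivity|].
  rewrite IH by (intros; apply H; now right). rewrite H by now left. reflexivity.
Qed.

Lemma csum_plus c c' L :
  csum (fun x => Cplus (c x) (c' x)) L = Cplus (csum c L) (csum c' L).
Proof.
  unfold csum; induction L as [|x L IH]; simpl; [ring | rewrite IH; ring].
Qed.

Lemma csum_scal k c L : csum (fun x => Cmult k (c x)) L = Cmult k (csum c L).
Proof.
  unfold csum; induction L as [|x L IH]; simpl; [ring | rewrite IH; ring].
Qed.

Lemma csum_conj c L : csum (fun x => Cconj (c x)) L = Cconj (csum c L).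
Proof.
  unfold csum; induction L as [|x L IH]; simpl.
  - unfold Cconj, RtoC; simpl. now rewrite Ropp_0.
  - rewrite IH. symmetry; apply Cplus_conj.
Qed.

Lemma csum_const k L : csum (fun _ : T => k) L = Cmult (RtoC (INR (length L))) k.
Proof.
  unfold csum; induction L as [|x L IH].
  - simpl. ring.
  - cbn [length map fold_right]. rewrite S_INR, RtoC_plus, IH. ring.
Qed.

Lemma rsum_le h h' L : (forall x, In x L -> h x <= h' x) -> rsum h L <= rsum h' L.
Proof.
  unfold rsum; induction L as [|x L IH]; simpl; intros H; [lra|].
  specialize (IH (fun y Hy => H y (or_intror Hy))).
  pose proof (H x (or_introl eq_refl)). lra.
Qed.

Lemma rsum_const k L : rsum (fun _ : T => k) L = INR (length L) * k.
Proof.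
  unfold rsum; induction L as [|x L IH].
  - simpl. ring.
  - cbn [length map fold_right]. rewrite S_INR, IH. ring.
Qed.

Lemma rsum_scal k h L : rsum (fun x => k * h x) L = k * rsum h L.
Proof.
  unfold rsum; induction L as [|x L IH]; simpl; [ring | rewrite IH; ring].
Qed.

Lemma rsum_nonneg h L : (forall x, In x L -> 0 <= h x) -> 0 <= rsum h L.
Proof.
  intros H. apply Rle_trans with (rsum (fun _ => 0) L).
  - rewrite rsum_const. lra.
  - now apply rsum_le.
Qed.

Lemma Cmod_csum_le c h L :
  (forall x, In x L -> Cmod (c x) <= h x) -> Cmod (csum c L) <= rsum h L.
Proof.
  unfold csum, rsum; induction L as [|x L IH]; simpl; intros H.
  - rewrite Cmod_0. lra.
  - specialize (IH (fun y Hy => H y (or_intror Hy))).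
    pose proof (H x (or_introl eq_refl)).
    eapply Rle_trans; [apply Cmod_triangle|]. lra.
Qed.

Lemma NoDup_incl_split L M :
  NoDup L -> NoDup M -> incl L M -> exists N, Permutation M (L ++ N).
Proof.
  revert M; induction L as [|x L IH]; intros M HL HM Hi.
  - now exists M.
  - inversion HL; subst.
    assert (Hx : In x M) by (apply Hi; now left).
    apply in_split in Hx; destruct Hx as [M1 [M2 ->]].
    destruct (IH (M1 ++ M2)) as [N HN]; auto.
    + now apply NoDup_remove_1 in HM.
    + intros y Hy. assert (Hy' : In y (M1 ++ x :: M2)) by (apply Hi; now right).
      apply in_app_or in Hy'. apply in_or_app.
      destruct Hy' as [Hy'|[Hy'|Hy']]; auto. subst; contradiction.
    + exists N. rewrite <- Permutation_middle. simpl. now constructor.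
Qed.

Lemma rsum_incl h L M :
  (forall x, 0 <= h x) -> NoDup L -> NoDup M -> incl L M -> rsum h L <= rsum h M.
Proof.
  intros Hh HL HM Hi. destruct (NoDup_incl_split L M HL HM Hi) as [N HN].
  rewrite (rsum_perm h _ _ HN), rsum_app.
  pose proof (rsum_nonneg h N (fun x _ => Hh x)). lra.
Qed.

(** The two sums differ by the sum over the complement of [L] in [M], where the domination by [h]
    applies. *)
Lemma csum_incl_dist c h K L M :
  (forall x, In x M -> Cmod (c x) <= K * h x) ->
  NoDup L -> NoDup M -> incl L M ->
  Cmod (Cminus (csum c L) (csum c M)) <= K * (rsum h M - rsum h L).
Proof.
  intros Hc HL HM Hi. destruct (NoDup_incl_split L M HL HM Hi) as [N HN].
  rewrite (rsum_perm h _ _ HN), (csum_perm c _ _ HN), rsum_app, csum_app.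
  replace (Cminus (csum c L) (Cplus (csum c L) (csum c N))) with (Copp (csum c N)) by ring.
  rewrite Cmod_opp.
  replace (K * (rsum h L + rsum h N - rsum h L)) with (rsum (fun x => K * h x) N)
    by (rewrite rsum_scal; ring).
  apply Cmod_csum_le. intros x Hx. apply Hc.
  apply (Permutation_in x (Permutation_sym HN)), in_or_app. now right.
Qed.

End FiniteSums.

Lemma csum_map {T U : Type} (c : U -> C) (g : T -> U) L :
  csum c (map g L) = csum (fun x => c (g x)) L.
Proof. unfold csum. now rewrite map_map. Qed.

(** * Lattice points and boxes *)

Definition vneg (x : list Z) : list Z := map Z.opp x.
Definition norm1 (x : list Z) : Z := fold_right (fun z s => (Z.abs z + s)%Z) 0%Z x.

Lemma pt_vadd D x y : pt D x -> pt D y -> pt D (vadd x y).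
Proof.
  unfold pt, vadd. intros Hx Hy. rewrite length_map, length_combine. lia.
Qed.

Lemma pt_vneg D x : pt D x -> pt D (vneg x).
Proof. unfold pt, vneg. now rewrite length_map. Qed.

Lemma pt_zeros D : pt D (zeros D).
Proof. apply repeat_length. Qed.

Lemma vadd_comm x y : vadd x y = vadd y x.
Proof.
  unfold vadd. revert y; induction x as [|a x IH]; intros [|b y]; simpl; auto.
  now rewrite IH, Z.add_comm.
Qed.

Lemma vadd_assoc x y z : vadd x (vadd y z) = vadd (vadd x y) z.
Proof.
  unfold vadd. revert y z; induction x as [|a x IH]; intros [|b y] [|c z]; simpl; auto.
  now rewrite IH, Z.add_assoc.
Qed.

Lemma vadd_zeros D x : pt D x -> vadd x (zeros D) = x.
Proof.
  unfold pt, vadd, zeros. intros <-. induction x as [|a x IH]; simpl; auto.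
  now rewrite IH, Z.add_0_r.
Qed.

Lemma vadd_vneg D x : pt D x -> vadd x (vneg x) = zeros D.
Proof.
  unfold pt, vadd, zeros, vneg. intros <-. induction x as [|a x IH]; simpl; auto.
  rewrite IH. f_equal. lia.
Qed.

Lemma vneg_involutive x : vneg (vneg x) = x.
Proof.
  unfold vneg. rewrite map_map. rewrite <- (map_id x) at 2.
  apply map_ext. intros; lia.
Qed.

Lemma vadd_vnegK D x y : pt D x -> pt D y -> vadd (vadd x (vneg y)) y = x.
Proof.
  intros Hx Hy. rewrite <- vadd_assoc, (vadd_comm _ y), (vadd_vneg D y Hy).
  now apply vadd_zeros.
Qed.

Lemma vadd_vnegK' D x y : pt D x -> pt D y -> vadd (vadd x y) (vneg y) = x.
Proof.
  intros Hx Hy. rewrite <- vadd_assoc, (vadd_vneg D y Hy). now apply vadd_zeros.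
Qed.

Lemma ldist_zeros D x : pt D x -> ldist x (zeros D) = norm1 x.
Proof.
  unfold pt, ldist, zeros, norm1. intros <-. induction x as [|a x IH]; simpl; auto.
  rewrite IH. f_equal. lia.
Qed.

Lemma norm1_nonneg x : (0 <= norm1 x)%Z.
Proof. unfold norm1; induction x as [|a x IH]; simpl; lia. Qed.

Lemma norm1_zeros D : norm1 (zeros D) = 0%Z.
Proof. unfold zeros. induction D as [|d IH]; [reflexivity | exact IH]. Qed.

Lemma norm1_vadd x y : (norm1 (vadd x y) <= norm1 x + norm1 y)%Z.
Proof.
  unfold vadd. revert y; induction x as [|a x IH]; intros [|b y]; simpl.
  - lia.
  - pose proof (norm1_nonneg y). unfold norm1 in *; simpl in *; lia.
  - pose proof (norm1_nonneg x). unfold norm1 in *; simpl in *; lia.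
  - specialize (IH y). unfold norm1 in *; simpl in *; lia.
Qed.

(** Reverse triangle inequality in each coordinate; equal lengths keep [combine] from truncating. It
    separates a translated support from a fixed one. *)
Lemma ldist_shift_lower D z x y : pt D z -> pt D x -> pt D y ->
  (norm1 x - norm1 z - norm1 y <= ldist (vadd z x) y)%Z.
Proof.
  unfold pt, vadd, ldist, norm1. intros <-. revert x y.
  induction z as [|a z IH]; intros [|b x] [|c y]; simpl; try discriminate; intros Hx Hy.
  injection Hx as Hx; injection Hy as Hy. specialize (IH x y Hx Hy). lia.
Qed.

(** The list of coordinates inlined in [box]; naming it lets [fold] expose the product structure. *)
Definition zrange (n : nat) : list Z :=
  map (fun k => (Z.of_nat k - Z.of_nat n)%Z) (seq 0 (2 * n + 1)).

Lemma In_zrange z n : In z (zrange n) <-> (Z.abs z <= Z.of_nat n)%Z.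
Proof.
  unfold zrange. rewrite in_map_iff. split.
  - intros [k [<- Hk]]. apply in_seq in Hk. lia.
  - intros H. exists (Z.to_nat (z + Z.of_nat n)). split; [lia|].
    apply in_seq. lia.
Qed.

Lemma NoDup_zrange n : NoDup (zrange n).
Proof.
  apply NoDup_map_NoDup_ForallPairs; [|apply seq_NoDup].
  intros a b _ _ H. lia.
Qed.

Lemma In_box d n x :
  In x (box d n) <-> pt d x /\ List.Forall (fun z => (Z.abs z <= Z.of_nat n)%Z) x.
Proof.
  revert x; induction d as [|d IH]; intros x; cbn [box].
  - unfold pt. split.
    + intros [<-|[]]. auto.
    + intros [H _]. apply length_zero_iff_nil in H. subst. now left.
  - fold (zrange n). rewrite in_flat_map. split.
    + intros [z [Hz Hx]]. apply in_map_iff in Hx. destruct Hx as [y [<- Hy]].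
      apply IH in Hy. destruct Hy as [Hy1 Hy2]. apply In_zrange in Hz.
      split; [unfold pt in *; simpl; congruence | now constructor].
    + intros [Hp Hf]. destruct x as [|z x]; [discriminate Hp|].
      injection Hp as Hp. inversion Hf; subst. exists z.
      rewrite In_zrange. split; auto. apply in_map. apply IH. now split.
Qed.

Lemma NoDup_box d n : NoDup (box d n).
Proof.
  induction d as [|d IH]; cbn [box].
  - repeat constructor. intros [].
  - fold (zrange n). pose proof (NoDup_zrange n) as Hz.
    induction (zrange n) as [|z l IHl]; simpl; [constructor|].
    inversion Hz; subst. apply NoDup_app.
    + apply NoDup_map_NoDup_ForallPairs; auto. intros a b _ _ H. now injection H.
    + auto.
    + intros x Hx Hx'. apply in_map_iff in Hx. destruct Hx as [y [<- _]].
      apply in_flat_map in Hx'. destruct Hx' as [z' [Hz' Hx']].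
      apply in_map_iff in Hx'. destruct Hx' as [y' [E _]].
      injection E; intros; subst. contradiction.
Qed.

Lemma length_box d n : length (box d n) = ((2 * n + 1) ^ d)%nat.
Proof.
  induction d as [|d IH]; [reflexivity|].
  cbn [box]. fold (zrange n).
  rewrite (flat_map_constant_length (c := length (box d n))).
  - unfold zrange. rewrite length_map, length_seq, IH. reflexivity.
  - intros. apply length_map.
Qed.

Lemma INR_length_box_pos d n : 0 < INR (length (box d n)).
Proof.
  apply lt_0_INR. rewrite length_box.
  assert ((2 * n + 1) ^ d <> 0)%nat by (apply Nat.pow_nonzero; lia). lia.
Qed.

Lemma box_incl d m n : (m <= n)%nat -> incl (box d m) (box d n).
Proof.
  intros H x Hx. apply In_box in Hx. apply In_box. destruct Hx as [Hp Hf].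
  split; auto. eapply List.Forall_impl; [|exact Hf]. simpl. intros; lia.
Qed.

Lemma box_vadd d m n x y : In x (box d m) -> In y (box d n) -> In (vadd x y) (box d (m + n)).
Proof.
  rewrite !In_box. intros [Px Fx] [Py Fy]. split; [now apply pt_vadd|].
  unfold pt in *. clear Px Py. unfold vadd. revert y Fy; induction Fx as [|a x Ha Fx IH];
    intros y Fy; simpl; [constructor|].
  inversion Fy; subst; constructor; simpl; [lia | auto].
Qed.

Lemma box_vneg d n x : In x (box d n) -> In (vneg x) (box d n).
Proof.
  rewrite !In_box. intros [Px Fx]. split; [now apply pt_vneg|].
  unfold vneg. rewrite List.Forall_map. eapply List.Forall_impl; [|exact Fx]. simpl. intros; lia.
Qed.

Lemma pt_in_box d x n : pt d x -> (norm1 x <= Z.of_nat n)%Z -> In x (box d n).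
Proof.
  intros Hp Hn. apply In_box. split; auto. clear Hp.
  induction x as [|a x IH]; constructor; pose proof (norm1_nonneg x); unfold norm1 in *;
    simpl in *; [lia | apply IH; lia].
Qed.

(** The factor [d] between the two norms is the source of the divisions by [D] in the box sizes used
    for charges. *)
Lemma norm1_box d n x : In x (box d n) -> (norm1 x <= Z.of_nat (d * n))%Z.
Proof.
  rewrite In_box. intros [Hp Hf]. unfold pt in Hp. subst d.
  induction Hf as [|a x Ha Hf IH]; unfold norm1 in *; simpl in *; lia.
Qed.

Lemma In_ballL D n x : In x (ballL D n) <-> ballP D n x.
Proof.
  unfold ballL, ballP. rewrite filter_In, Z.leb_le. split.
  - intros [Hb Hd]. apply In_box in Hb. tauto.
  - intros [Hp Hd]. split; auto. apply pt_in_box; auto.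
    now rewrite <- (ldist_zeros D x Hp).
Qed.

Lemma NoDup_ballL D n : NoDup (ballL D n).
Proof. apply NoDup_filter, NoDup_box. Qed.

Lemma ballP_norm1 D n x : ballP D n x <-> pt D x /\ (norm1 x <= Z.of_nat n)%Z.
Proof.
  unfold ballP. split; intros [Hp Hd]; split; auto; now rewrite (ldist_zeros D x Hp) in *.
Qed.

Lemma box_incl_ballL D m n : (D * m <= n)%nat -> incl (box D m) (ballL D n).
Proof.
  intros H x Hx. apply In_ballL, ballP_norm1. pose proof (norm1_box _ _ _ Hx).
  apply In_box in Hx. split; [tauto | lia].
Qed.

Lemma finite_in_box D (L : list (list Z)) :
  (forall x, In x L -> pt D x) -> exists n, forall m, (n <= m)%nat -> incl L (box D m).
Proof.
  induction L as [|x L IH]; intros H.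
  - exists O. intros m _ y [].
  - destruct IH as [n Hn]; [intros; apply H; now right|].
    exists (Nat.max n (Z.to_nat (norm1 x))). intros m Hm y [<-|Hy].
    + apply pt_in_box; [apply H; now left|]. pose proof (norm1_nonneg x). lia.
    + apply Hn; auto. lia.
Qed.

Lemma NoDup_map_vadd D v L : pt D v -> (forall x, In x L -> pt D x) -> NoDup L ->
  NoDup (map (fun x => vadd x v) L).
Proof.
  intros Hv HL. apply NoDup_map_NoDup_ForallPairs. intros x y Hx Hy E.
  rewrite <- (vadd_vnegK' D x v), <- (vadd_vnegK' D y v); auto. now rewrite E.
Qed.

(** * Limits of complex sequences *)

(** Convergence in the modulus, which suits Cauchy-Schwarz; the filter [locally] on [C] comes from
    the coordinatewise distance, and [Clim_filterlim] reconciles the two. *)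
Definition Clim (u : nat -> C) (l : C) : Prop :=
  forall eps, 0 < eps -> exists N, forall n, (N <= n)%nat -> Cmod (Cminus (u n) l) < eps.

Lemma Cmod_le_Re_Im z : Cmod z <= Rabs (Re z) + Rabs (Im z).
Proof.
  replace z with (Cplus (RtoC (Re z)) (Cmult Ci (RtoC (Im z)))) at 1.
  - eapply Rle_trans; [apply Cmod_triangle|].
    rewrite Cmod_mult, Cmod_Ci, !Cmod_R. lra.
  - destruct z as [a b]. apply injective_projections; simpl; ring.
Qed.

Lemma Rabs_Im_le z : Rabs (Im z) <= Cmod z.
Proof. eapply Rle_trans; [apply Rmax_r | apply Rmax_Cmod]. Qed.

Lemma Clim_filterlim (u : nat -> C) (l : C) :
  filterlim u eventually (locally l) <-> Clim u l.
Proof.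
  split.
  - intros H eps He. assert (He2 : 0 < eps / 2) by lra.
    destruct (proj1 (filterlim_locally u l) H (mkposreal _ He2)) as [N HN].
    exists N. intros n Hn. destruct (HN n Hn) as [H1 H2].
    unfold ball, prod_ball in H1, H2; simpl in H1, H2.
    change (Rabs (minus (fst (u n)) (fst l)) < eps / 2) in H1.
    change (Rabs (minus (snd (u n)) (snd l)) < eps / 2) in H2.
    eapply Rle_lt_trans; [apply Cmod_le_Re_Im|].
    change (Rabs (Re (Cminus (u n) l))) with (Rabs (minus (fst (u n)) (fst l))).
    change (Rabs (Im (Cminus (u n) l))) with (Rabs (minus (snd (u n)) (snd l))).
    lra.
  - intros H. apply (proj2 (filterlim_locally u l)). intros eps.
    destruct (H eps (cond_pos eps)) as [N HN]. exists N. intros n Hn. specialize (HN n Hn).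
    split.
    + change (Rabs (Re (Cminus (u n) l)) < eps). pose proof (re_le_Cmod (Cminus (u n) l)). lra.
    + change (Rabs (Im (Cminus (u n) l)) < eps). pose proof (Rabs_Im_le (Cminus (u n) l)). lra.
Qed.

Lemma Clim_Re u l : Clim u l -> is_lim_seq (fun n => Re (u n)) (Re l).
Proof.
  intros H. apply is_lim_seq_spec. intros eps.
  destruct (H eps (cond_pos eps)) as [N HN]. exists N. intros n Hn. specialize (HN n Hn).
  change (Rabs (Re (Cminus (u n) l)) < eps). pose proof (re_le_Cmod (Cminus (u n) l)). lra.
Qed.

Lemma Clim_Im u l : Clim u l -> is_lim_seq (fun n => Im (u n)) (Im l).
Proof.
  intros H. apply is_lim_seq_spec. intros eps.
  destruct (H eps (cond_pos eps)) as [N HN]. exists N. intros n Hn. specialize (HN n Hn).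
  change (Rabs (Im (Cminus (u n) l)) < eps). pose proof (Rabs_Im_le (Cminus (u n) l)). lra.
Qed.

Lemma Clim_unique u l l' : Clim u l -> Clim u l' -> l = l'.
Proof.
  intros H H'. apply injective_projections.
  - assert (E := is_lim_seq_unique _ _ (Clim_Re _ _ H)).
    rewrite (is_lim_seq_unique _ _ (Clim_Re _ _ H')) in E. now injection E.
  - assert (E := is_lim_seq_unique _ _ (Clim_Im _ _ H)).
    rewrite (is_lim_seq_unique _ _ (Clim_Im _ _ H')) in E. now injection E.
Qed.

Lemma Clim_complete u :
  (forall eps, 0 < eps -> exists N, forall m n, (N <= m)%nat -> (N <= n)%nat ->
     Cmod (Cminus (u m) (u n)) < eps) -> exists l, Clim u l.
Proof.
  intros H.
  assert (HR : ex_finite_lim_seq (fun n => Re (u n))).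
  { apply ex_lim_seq_cauchy_corr. intros eps. destruct (H eps (cond_pos eps)) as [N HN].
    exists N. intros n m Hn Hm. specialize (HN n m Hn Hm).
    change (Rabs (Re (Cminus (u n) (u m))) < eps).
    pose proof (re_le_Cmod (Cminus (u n) (u m))). lra. }
  assert (HI : ex_finite_lim_seq (fun n => Im (u n))).
  { apply ex_lim_seq_cauchy_corr. intros eps. destruct (H eps (cond_pos eps)) as [N HN].
    exists N. intros n m Hn Hm. specialize (HN n m Hn Hm).
    change (Rabs (Im (Cminus (u n) (u m))) < eps).
    pose proof (Rabs_Im_le (Cminus (u n) (u m))). lra. }
  destruct HR as [a Ha], HI as [b Hb]. exists (a, b). intros eps He.
  assert (He2 : 0 < eps / 2) by lra.
  destruct (proj2 (is_lim_seq_spec _ _) Ha (mkposreal _ He2)) as [N1 H1].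
  destruct (proj2 (is_lim_seq_spec _ _) Hb (mkposreal _ He2)) as [N2 H2].
  exists (Nat.max N1 N2). intros n Hn.
  specialize (H1 n ltac:(lia)). specialize (H2 n ltac:(lia)). simpl in H1, H2.
  eapply Rle_lt_trans; [apply Cmod_le_Re_Im|].
  change (Re (Cminus (u n) (a, b))) with (Re (u n) - a).
  change (Im (Cminus (u n) (a, b))) with (Im (u n) - b). lra.
Qed.

Lemma Clim_ext u v l : (forall n, u n = v n) -> Clim u l -> Clim v l.
Proof.
  intros E H eps He. destruct (H eps He) as [N HN]. exists N. intros n Hn.
  rewrite <- E. auto.
Qed.

Lemma Clim_const l : Clim (fun _ => l) l.
Proof.
  intros eps He. exists O. intros. replace (Cminus l l) with (RtoC 0) by ring.
  now rewrite Cmod_0.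
Qed.

Lemma Clim_plus u v l l' :
  Clim u l -> Clim v l' -> Clim (fun n => Cplus (u n) (v n)) (Cplus l l').
Proof.
  intros H H' eps He. destruct (H (eps / 2)) as [N HN]; [lra|].
  destruct (H' (eps / 2)) as [N' HN']; [lra|]. exists (Nat.max N N'). intros n Hn.
  specialize (HN n ltac:(lia)). specialize (HN' n ltac:(lia)).
  replace (Cminus (Cplus (u n) (v n)) (Cplus l l'))
    with (Cplus (Cminus (u n) l) (Cminus (v n) l')) by ring.
  pose proof (Cmod_triangle (Cminus (u n) l) (Cminus (v n) l')). lra.
Qed.

Lemma Clim_scal k u l : Clim u l -> Clim (fun n => Cmult k (u n)) (Cmult k l).
Proof.
  intros H eps He. pose proof (Cmod_ge_0 k).
  destruct (H (eps / (Cmod k + 1))) as [N HN]; [apply Rdiv_lt_0_compat; lra|].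
  exists N. intros n Hn. specialize (HN n Hn).
  replace (Cminus (Cmult k (u n)) (Cmult k l)) with (Cmult k (Cminus (u n) l)) by ring.
  rewrite Cmod_mult. pose proof (Cmod_ge_0 (Cminus (u n) l)).
  apply (Rmult_lt_compat_l (Cmod k + 1)) in HN; [|lra].
  replace ((Cmod k + 1) * (eps / (Cmod k + 1))) with eps in HN by (field; lra). nra.
Qed.

Lemma Clim_minus u v l l' :
  Clim u l -> Clim v l' -> Clim (fun n => Cminus (u n) (v n)) (Cminus l l').
Proof.
  intros H H'.
  replace (Cminus l l') with (Cplus l (Cmult (RtoC (-1)) l')) by ring.
  eapply Clim_ext; [|apply (Clim_plus _ _ _ _ H (Clim_scal (RtoC (-1)) _ _ H'))].
  intros n. simpl. ring.
Qed.

Lemma Clim_conj u l : Clim u l -> Clim (fun n => Cconj (u n)) (Cconj l).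
Proof.
  intros H eps He. destruct (H eps He) as [N HN]. exists N. intros n Hn.
  rewrite <- Cminus_conj, Cmod_conj. auto.
Qed.

Lemma Clim_subseq u l (j : nat -> nat) :
  (forall N, exists M, forall n, (M <= n)%nat -> (N <= j n)%nat) ->
  Clim u l -> Clim (fun n => u (j n)) l.
Proof.
  intros Hj H eps He. destruct (H eps He) as [N HN]. destruct (Hj N) as [M HM].
  exists M. auto.
Qed.

Lemma Clim_squeeze u v l (e : nat -> R) :
  Clim v l -> is_lim_seq e 0 ->
  (exists N, forall n, (N <= n)%nat -> Cmod (Cminus (u n) (v n)) <= e n) -> Clim u l.
Proof.
  intros Hv He [N HN] eps Heps.
  destruct (Hv (eps / 2)) as [N1 H1]; [lra|].
  assert (He2 : 0 < eps / 2) by lra.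
  destruct (proj2 (is_lim_seq_spec _ _) He (mkposreal _ He2)) as [N2 H2]. simpl in H2.
  exists (Nat.max N (Nat.max N1 N2)). intros n Hn.
  specialize (HN n ltac:(lia)). specialize (H1 n ltac:(lia)). specialize (H2 n ltac:(lia)).
  replace (Cminus (u n) l) with (Cplus (Cminus (u n) (v n)) (Cminus (v n) l)) by ring.
  pose proof (Cmod_triangle (Cminus (u n) (v n)) (Cminus (v n) l)).
  rewrite Rminus_0_r in H2. pose proof (Rle_abs (e n)). lra.
Qed.

(** * A summable weight *)

Section Weight.
Variable q : R.
Hypothesis Hq : 1 < q.

Definition gwt (z : Z) : R := Rpower (1 + IZR (Z.abs z)) (- q).

Definition wt (x : list Z) : R := fold_right (fun z s => gwt z * s) 1 x.

Lemma gwt_pos z : 0 < gwt z.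
Proof. apply exp_pos. Qed.

Lemma wt_pos x : 0 < wt x.
Proof.
  induction x as [|z x IH]; simpl; [lra|]. pose proof (gwt_pos z). nra.
Qed.

(** Comparison with the integral of y^(-q), done without integration: with y = k + 2 and u = ln (y /
    (y - 1)), the ratio of the two powers is exp ((q - 1) u), and exp t >= 1 + t gives both u >= 1/y
    and the claim. *)
Lemma Rpower_neg_telescope (k : nat) :
  (q - 1) * Rpower (INR k + 2) (- q) <=
  Rpower (INR k + 1) (1 - q) - Rpower (INR k + 2) (1 - q).
Proof.
  pose proof (pos_INR k) as Hk.
  set (y := INR k + 2). set (u := ln y - ln (INR k + 1)).
  assert (Hu : 1 / y <= u).
  { unfold u. assert (Hy : 0 < y) by (unfold y; lra).
    assert (Hr : 0 < (INR k + 1) / y) by (apply Rdiv_lt_0_compat; lra).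
    pose proof (exp_ineq1_le (ln ((INR k + 1) / y))) as He.
    rewrite exp_ln in He by assumption. rewrite ln_div in He by lra.
    assert (E : (INR k + 1) / y = 1 - 1 / y) by (unfold y; field; lra).
    rewrite E in He. lra. }
  assert (E1 : Rpower (INR k + 1) (1 - q) = Rpower y (1 - q) * exp ((q - 1) * u)).
  { unfold Rpower, u. rewrite <- exp_plus. f_equal. ring. }
  assert (E2 : Rpower y (1 - q) = Rpower y (- q) * y).
  { replace (1 - q) with (- q + 1) by ring. rewrite Rpower_plus, Rpower_1; [reflexivity|].
    unfold y; lra. }
  rewrite E1. pose proof (exp_ineq1_le ((q - 1) * u)) as He.
  assert (Hy : 0 < y) by (unfold y; lra).
  assert (Hp : 0 < Rpower y (- q)) by apply exp_pos.
  assert (H1 : (q - 1) * (1 / y) <= exp ((q - 1) * u) - 1) by nra.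
  replace (Rpower y (1 - q) * exp ((q - 1) * u) - Rpower y (1 - q))
    with (Rpower y (1 - q) * (exp ((q - 1) * u) - 1)) by ring.
  rewrite E2.
  replace ((q - 1) * Rpower y (- q))
    with (Rpower y (- q) * y * ((q - 1) * (1 / y))) by (field; lra).
  apply Rmult_le_compat_l; nra.
Qed.

Lemma rsum_gwt_zrange n : rsum gwt (zrange n) <= 1 + 2 / (q - 1).
Proof.
  (* The induction has to carry the telescoped remainder. The factor 2 counts the points n and -n,
     the leading term is the origin. *)
  assert (Hs : (q - 1) * rsum gwt (zrange n)
                <= (q - 1) + 2 * (1 - Rpower (INR n + 1) (1 - q))).
  { induction n as [|n IH].
    - unfold zrange, rsum, gwt; simpl. rewrite !Rplus_0_l, !Rplus_0_r.
      unfold Rpower. rewrite ln_1, !Rmult_0_r, exp_0. lra.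
    - assert (HP : Permutation (zrange (S n))
                     (Z.of_nat (S n) :: (- Z.of_nat (S n))%Z :: zrange n)).
      { apply NoDup_Permutation.
        - apply NoDup_zrange.
        - constructor; [|constructor; [|apply NoDup_zrange]].
          + intros [H|H]; [lia|]. apply In_zrange in H. lia.
          + intros H. apply In_zrange in H. lia.
        - intros z. cbn [In]. rewrite !In_zrange. lia. }
      rewrite (rsum_perm _ _ _ HP). unfold rsum in *. cbn [map fold_right].
      assert (E : forall z, Z.abs z = Z.of_nat (S n) -> gwt z = Rpower (INR n + 2) (- q)).
      { intros z Hz. unfold gwt. rewrite Hz, <- INR_IZR_INZ, S_INR. f_equal. ring. }
      rewrite (E (Z.of_nat (S n))), (E (- Z.of_nat (S n))%Z) by lia.
      pose proof (Rpower_neg_telescope n). rewrite S_INR.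
      replace (INR n + 1 + 1) with (INR n + 2) by ring. lra. }
  assert (0 < Rpower (INR n + 1) (1 - q)) by apply exp_pos.
  apply (Rmult_le_reg_l (q - 1)); [lra|].
  replace ((q - 1) * (1 + 2 / (q - 1))) with (q - 1 + 2) by (field; lra). lra.
Qed.

(** The sum of a product over a product set factors; the weight has product form for this reason. *)
Lemma rsum_wt_box d n : rsum wt (box d n) = rsum gwt (zrange n) ^ d.
Proof.
  induction d as [|d IH]; [unfold rsum; simpl; ring|].
  cbn [box pow]. fold (zrange n). rewrite <- IH. clear IH.
  induction (zrange n) as [|z l IHl]; [unfold rsum; simpl; ring|].
  simpl. rewrite rsum_app, IHl.
  assert (E : rsum wt (map (cons z) (box d n)) = gwt z * rsum wt (box d n)).
  { rewrite <- rsum_scal. unfold rsum. now rewrite map_map. }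
  rewrite E. unfold rsum; simpl. ring.
Qed.

(** Every factor 1 + |x_i| is at most 1 + s. With q = p/D and D coordinates the exponent becomes p,
    so decay in the distance is dominated by the weight. A free [s] survives the induction, where
    the norm of the tail shrinks. *)
Lemma wt_lower (x : list Z) (s : R) :
  IZR (norm1 x) <= s -> Rpower (1 + s) (- (q * INR (length x))) <= wt x.
Proof.
  revert s; induction x as [|z x IH]; intros s Hs.
  - simpl. rewrite Rmult_0_r, Ropp_0. unfold Rpower. rewrite Rmult_0_l, exp_0. lra.
  - cbn [length wt fold_right]. fold (wt x). rewrite S_INR.
    replace (- (q * (INR (length x) + 1))) with (- q + - (q * INR (length x))) by ring.
    rewrite Rpower_plus.
    pose proof (norm1_nonneg x) as H0. pose proof (Z.abs_nonneg z) as H1.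
    apply IZR_le in H0, H1. unfold norm1 in Hs; simpl in Hs. fold (norm1 x) in Hs.
    rewrite plus_IZR in Hs.
    assert (Hpos : forall a b, 0 <= Rpower a b) by (intros; left; apply exp_pos).
    apply Rmult_le_compat; auto.
    + unfold gwt. rewrite !Rpower_Ropp. apply Rinv_le_contravar; [apply exp_pos|].
      apply Rle_Rpower_l; lra.
    + apply IH. lra.
Qed.

Variable D : nat.

Lemma wt_box_limit : exists H : R, is_lim_seq (fun n => rsum wt (box D n)) H /\
  forall L, (forall x, In x L -> pt D x) -> NoDup L -> rsum wt L <= H.
Proof.
  assert (Hincr : forall m n, (m <= n)%nat -> rsum wt (box D m) <= rsum wt (box D n)).
  { intros. apply rsum_incl; try apply NoDup_box.
    - intros; left; apply wt_pos.
    - now apply box_incl. }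
  assert (Hb : exists H : R, is_lim_seq (fun n => rsum wt (box D n)) H).
  { apply ex_finite_lim_seq_incr with ((1 + 2 / (q - 1)) ^ D).
    - intros; apply Hincr; lia.
    - intros n. rewrite rsum_wt_box. apply pow_incr. split; [|apply rsum_gwt_zrange].
      apply rsum_nonneg. intros; left; apply gwt_pos. }
  destruct Hb as [H HH]. exists H. split; auto. intros L HL HN.
  destruct (finite_in_box D L HL) as [n Hn].
  apply Rle_trans with (rsum wt (box D n)).
  - apply rsum_incl; auto using NoDup_box. intros; left; apply wt_pos.
  - apply (is_lim_seq_incr_compare _ _ HH). intros; apply Hincr; lia.
Qed.

Definition wtot : R := proj1_sig (constructive_indefinite_description _ wt_box_limit).

(** For a duplicate-free [L] of lattice points this is the mass of the weight outside [L], the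
    common error term of all lattice sums. *)
Definition wtail (L : list (list Z)) : R := wtot - rsum wt L.

Lemma wtail_box_lim : is_lim_seq (fun n => wtail (box D n)) 0.
Proof.
  unfold wtail, wtot. destruct (constructive_indefinite_description _ wt_box_limit) as [H [HH1 HH2]].
  simpl. replace (Finite 0) with (Rbar_minus H H) by (simpl; f_equal; ring).
  apply is_lim_seq_minus'; auto. apply is_lim_seq_const.
Qed.

Lemma wtail_nonneg L : (forall x, In x L -> pt D x) -> NoDup L -> 0 <= wtail L.
Proof.
  unfold wtail, wtot. destruct (constructive_indefinite_description _ wt_box_limit) as [H [HH1 HH2]].
  simpl. intros HL HN. specialize (HH2 L HL HN). lra.
Qed.

Lemma wtail_le_wtot L : wtail L <= wtot.
Proof.
  unfold wtail. pose proof (rsum_nonneg wt L (fun x _ => Rlt_le _ _ (wt_pos x))). lra.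
Qed.

Lemma wtail_incl L M : NoDup L -> NoDup M -> incl L M -> wtail M <= wtail L.
Proof.
  intros HL HM Hi. unfold wtail.
  pose proof (rsum_incl wt L M (fun x => Rlt_le _ _ (wt_pos x)) HL HM Hi). lra.
Qed.

(* Domination by a summable weight gives unconditional summation, with a
   remainder that depends on the dominated function only through [K]. *)
Lemma weighted_sum_limit (c : list Z -> C) (K : R) :
  (forall x, pt D x -> Cmod (c x) <= K * wt x) ->
  exists l, forall L, (forall x, In x L -> pt D x) -> NoDup L ->
    Cmod (Cminus (csum c L) l) <= K * wtail L.
Proof.
  intros Hc.
  assert (Hbox : forall n x, In x (box D n) -> pt D x) by (intros n x Hx; now apply In_box in Hx).
  assert (HK : 0 <= K).
  { specialize (Hc _ (pt_zeros D)). pose proof (Cmod_ge_0 (c (zeros D))).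
    pose proof (wt_pos (zeros D)). nra. }
  assert (Hd : forall L n, NoDup L -> incl L (box D n) ->
                 Cmod (Cminus (csum c L) (csum c (box D n))) <= K * wtail L).
  { intros L n HL Hi.
    eapply Rle_trans; [apply csum_incl_dist with (h := wt) (K := K)|]; auto using NoDup_box.
    - intros x Hx. apply Hc. eauto.
    - unfold wtail. pose proof (wtail_nonneg (box D n) (Hbox n) (NoDup_box D n)).
      unfold wtail in *. apply Rmult_le_compat_l; lra. }
  destruct (Clim_complete (fun n => csum c (box D n))) as [l Hl].
  { intros eps He. assert (He2 : 0 < eps / (K + 1)) by (apply Rdiv_lt_0_compat; lra).
    destruct (proj2 (is_lim_seq_spec _ _) wtail_box_lim (mkposreal _ He2)) as [N HN].
    simpl in HN. exists N.
    assert (Hlt : forall m, (N <= m)%nat -> K * wtail (box D m) < eps).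
    { intros m Hm. specialize (HN m Hm). rewrite Rminus_0_r in HN.
      pose proof (Rle_abs (wtail (box D m))).
      pose proof (wtail_nonneg (box D m) (Hbox m) (NoDup_box D m)).
      assert (Hw : wtail (box D m) < eps / (K + 1)) by lra.
      apply (Rmult_lt_compat_l (K + 1)) in Hw; [|lra].
      replace ((K + 1) * (eps / (K + 1))) with eps in Hw by (field; lra). nra. }
    intros m n Hm Hn. destruct (Nat.le_ge_cases m n) as [Hmn|Hmn].
    - eapply Rle_lt_trans; [apply Hd|apply (Hlt m Hm)]; auto using NoDup_box, box_incl.
    - rewrite <- Cmod_opp.
      replace (Copp (Cminus (csum c (box D m)) (csum c (box D n))))
        with (Cminus (csum c (box D n)) (csum c (box D m))) by ring.
      eapply Rle_lt_trans; [apply Hd|apply (Hlt n Hn)]; auto using NoDup_box, box_incl. }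
  (* If the bound failed, a box containing [L] whose sum is closer to [l] than the excess would
     contradict [Hd]. *)
  exists l. intros L HL HN. apply Rnot_lt_le. intros Hlt.
  destruct (Hl (Cmod (Cminus (csum c L) l) - K * wtail L)) as [N1 H1]; [lra|].
  destruct (finite_in_box D L HL) as [N2 H2].
  set (n := Nat.max N1 N2). specialize (H1 n ltac:(lia)). specialize (H2 n ltac:(lia)).
  pose proof (Hd L n HN H2).
  pose proof (Cmod_triangle (Cminus (csum c L) (csum c (box D n))) (Cminus (csum c (box D n)) l)) as Ht.
  replace (Cplus (Cminus (csum c L) (csum c (box D n))) (Cminus (csum c (box D n)) l))
    with (Cminus (csum c L) l) in Ht by ring. lra.
Qed.

End Weight.

(** * Positive semidefinite forms *)

Lemma functional_choice {A T : Type} (R : A -> T -> Prop) :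
  (forall x, exists y, R x y) -> exists f, forall x, R x (f x).
Proof.
  intros H. exists (fun x => proj1_sig (constructive_indefinite_description _ (H x))).
  intros x. apply proj2_sig.
Qed.

Lemma Clim_of_sq_bound u l (K : R) (e : nat -> R) :
  is_lim_seq e 0 -> (forall n, Cmod (Cminus (u n) l) ^ 2 <= K * e n) -> Clim u l.
Proof.
  intros He H eps Heps.
  assert (HK : is_lim_seq (fun n => K * e n) 0).
  { replace (Finite 0) with (Rbar_mult K 0) by (simpl; f_equal; ring).
    now apply is_lim_seq_scal_l. }
  assert (He2 : 0 < eps ^ 2) by (apply pow_lt; lra).
  destruct (proj2 (is_lim_seq_spec _ _) HK (mkposreal _ He2)) as [N HN]. simpl in HN.
  exists N. intros n Hn. specialize (HN n Hn). specialize (H n).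
  rewrite Rminus_0_r in HN. pose proof (Rle_abs (K * e n)).
  pose proof (Cmod_ge_0 (Cminus (u n) l)). simpl in H. nra.
Qed.

Section Forms.
Context {D : nat} (S : LatticeSystem D) (HS : LS_axioms S).
Local Notation O := (Obs S).

(** Abstract because Cauchy-Schwarz and its consequences are needed for [cov], [Lform] and the
    symmetrisations of both, one of which is [bra]. *)
Record PSDForm (B : O -> O -> C) : Prop := {
  form_addr : forall a b c, B a (oadd b c) = Cplus (B a b) (B a c);
  form_scalr : forall a k b, B a (oscal k b) = Cmult k (B a b);
  form_herm : forall a b, B a b = Cconj (B b a);
  form_pos : forall a, 0 <= Re (B a a)
}.

(** At [B := bra S omega] this is [CauchyH] up to conversion. *)
Definition CauchyFor (B : O -> O -> C) (s : nat -> O) : Prop :=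
  forall eps, 0 < eps -> exists N, forall m n, (N <= m)%nat -> (N <= n)%nat ->
    Re (B (osub S (s m) (s n)) (osub S (s m) (s n))) < eps.

Definition LinearFun (F : O -> C) : Prop :=
  (forall a b, F (oadd a b) = Cplus (F a) (F b)) /\ (forall k a, F (oscal k a) = Cmult k (F a)).

Section OneForm.
Variable B : O -> O -> C.
Hypothesis HB : PSDForm B.

Lemma form_addl a b c : B (oadd a b) c = Cplus (B a c) (B b c).
Proof.
  rewrite (form_herm B HB), (form_addr B HB), Cplus_conj, <- !(form_herm B HB). reflexivity.
Qed.

Lemma form_scall k a c : B (oscal k a) c = Cmult (Cconj k) (B a c).
Proof.
  rewrite (form_herm B HB), (form_scalr B HB), Cmult_conj, <- (form_herm B HB). reflexivity.
Qed.

Lemma form_subl a b c : B (osub S a b) c = Cminus (B a c) (B b c).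
Proof.
  unfold osub. rewrite form_addl, form_scall.
  replace (Cconj (RtoC (-1))) with (RtoC (-1)); [ring|].
  unfold Cconj, RtoC; simpl. now rewrite Ropp_0.
Qed.

Lemma form_subr a b c : B a (osub S b c) = Cminus (B a b) (B a c).
Proof. unfold osub. rewrite (form_addr B HB), (form_scalr B HB). ring. Qed.

Lemma form_diag_real a : B a a = RtoC (Re (B a a)).
Proof.
  apply injective_projections; simpl; [reflexivity|].
  assert (E := f_equal Im (form_herm B HB a a)). rewrite im_conj in E.
  change (snd (B a a)) with (Im (B a a)). lra.
Qed.

Lemma form_quad a k b :
  Re (B (oadd a (oscal k b)) (oadd a (oscal k b))) =
  Re (B a a) + 2 * Re (Cmult k (B a b)) + Cmod k ^ 2 * Re (B b b).
Proof.
  rewrite (form_addr B HB), !form_addl, !(form_scalr B HB), !form_scall.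
  rewrite (form_herm B HB b a), (form_diag_real b). rewrite Cmod2_alt.
  destruct k as [k1 k2], (B a b) as [z1 z2]. simpl. unfold Re. ring.
Qed.

Lemma form_parallelogram a b :
  Re (B (osub S a b) (osub S a b)) =
  2 * Re (B a a) + 2 * Re (B b b) - Re (B (oadd a b) (oadd a b)).
Proof.
  unfold osub. rewrite form_quad, (form_addr B HB), !form_addl, (form_herm B HB b a).
  rewrite Cmod_R, pow2_abs. destruct (B a a), (B b b), (B a b). simpl. ring.
Qed.

Lemma form_add_le a b :
  Re (B (oadd a b) (oadd a b)) <= 2 * Re (B a a) + 2 * Re (B b b).
Proof.
  pose proof (form_parallelogram a b). pose proof (form_pos B HB (osub S a b)). lra.
Qed.

Lemma form_split a b :
  Re (B a a) <= 2 * Re (B b b) + 2 * Re (B (osub S a b) (osub S a b)).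
Proof.
  pose proof (form_add_le b (osub S a b)) as H.
  (* The identity b + (a - b) = a is checked inside [B] by bilinearity rather than in the
     algebra. *)
  replace (Re (B (oadd b (osub S a b)) (oadd b (osub S a b)))) with (Re (B a a)) in H; [lra|].
  rewrite (form_addr B HB), !form_addl, !form_subl, !form_subr. f_equal. ring.
Qed.

Lemma form_cauchy_schwarz a b : Cmod (B a b) ^ 2 <= Re (B a a) * Re (B b b).
Proof.
  set (z := B a b). set (y := Cmod z ^ 2).
  assert (Hy : 0 <= y) by (apply pow_le, Cmod_ge_0).
  (* The test vector a + t conj(z) b makes the cross term real, leaving a quadratic polynomial in
     the real variable t. *)
  assert (Hq : forall t : R, 0 <= Re (B a a) + 2 * t * y + t ^ 2 * y * Re (B b b)).
  { intros t. pose proof (form_pos B HB (oadd a (oscal (Cmult (RtoC t) (Cconj z)) b))) as H.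
    rewrite form_quad in H. fold z in H.
    replace (Cmult (Cmult (RtoC t) (Cconj z)) z) with (RtoC (t * y)) in H.
    - rewrite Cmod_mult, Cmod_conj, Rpow_mult_distr, Cmod_R, pow2_abs in H. fold y in H.
      simpl (Re (RtoC _)) in H. lra.
    - unfold y. rewrite RtoC_mult. rewrite Cmod2_conj. ring. }
  pose proof (form_pos B HB a) as Ha. pose proof (form_pos B HB b) as Hb.
  destruct (Rle_lt_or_eq_dec _ _ Hb) as [Hb'|Hb'].
  - specialize (Hq (- / Re (B b b))).
    replace (Re (B a a) + 2 * - / Re (B b b) * y + (- / Re (B b b)) ^ 2 * y * Re (B b b))
      with (/ Re (B b b) * (Re (B a a) * Re (B b b) - y)) in Hq by (field; lra).
    pose proof (Rinv_0_lt_compat _ Hb'). fold y. nra.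
  (* When B(b,b) = 0 the polynomial is affine in t; unless y = 0, the chosen t makes it negative. *)
  - rewrite <- Hb' in *. fold y. destruct (Rle_lt_or_eq_dec _ _ Hy) as [Hy'|Hy']; [|lra].
    specialize (Hq (- (Re (B a a) + 1) / y)).
    replace (Re (B a a) + 2 * (- (Re (B a a) + 1) / y) * y
             + (- (Re (B a a) + 1) / y) ^ 2 * y * 0)
      with (- Re (B a a) - 2) in Hq by (field; lra). lra.
Qed.

Lemma cauchy_bounded s : CauchyFor B s -> exists M, 0 < M /\
  exists N, forall n, (N <= n)%nat -> Re (B (s n) (s n)) <= M.
Proof.
  intros H. destruct (H 1) as [N HN]; [lra|].
  pose proof (form_pos B HB (s N)).
  exists (2 * Re (B (s N) (s N)) + 2). split; [lra|].
  exists N. intros n Hn. pose proof (form_split (s n) (s N)).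
  specialize (HN n N Hn (le_n _)). lra.
Qed.

Lemma cauchy_pairing_cvg s a : CauchyFor B s -> exists l, Clim (fun n => B (s n) a) l.
Proof.
  intros H. apply Clim_complete. intros eps He.
  pose proof (form_pos B HB a) as Ha.
  destruct (H (eps ^ 2 / (Re (B a a) + 1))) as [N HN].
  { apply Rdiv_lt_0_compat; [apply pow_lt|]; lra. }
  exists N. intros m n Hm Hn. specialize (HN m n Hm Hn).
  rewrite <- form_subl.
  pose proof (form_cauchy_schwarz (osub S (s m) (s n)) a) as Hcs.
  pose proof (form_pos B HB (osub S (s m) (s n))) as Hp.
  set (d := Re (B (osub S (s m) (s n)) (osub S (s m) (s n)))) in *.
  apply (Rmult_lt_compat_r (Re (B a a) + 1)) in HN; [|lra].
  replace (eps ^ 2 / (Re (B a a) + 1) * (Re (B a a) + 1)) with (eps ^ 2) in HN by (field; lra).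
  pose proof (Cmod_ge_0 (B (osub S (s m) (s n)) a)). simpl in *. nra.
Qed.

Lemma equiv_pairing s t a l :
  (forall eps, 0 < eps -> exists N, forall n, (N <= n)%nat ->
     Re (B (osub S (s n) (t n)) (osub S (s n) (t n))) < eps) ->
  Clim (fun n => B (s n) a) l -> Clim (fun n => B (t n) a) l.
Proof.
  intros H Hs.
  assert (Hd : Clim (fun n => B (osub S (s n) (t n)) a) (RtoC 0)).
  { apply Clim_of_sq_bound with (K := Re (B a a))
      (e := fun n => Re (B (osub S (s n) (t n)) (osub S (s n) (t n)))).
    - apply is_lim_seq_spec. intros eps. destruct (H eps (cond_pos eps)) as [N HN].
      exists N. intros n Hn. rewrite Rminus_0_r, Rabs_pos_eq; auto. apply (form_pos B HB).
    - intros n. replace (Cminus (B (osub S (s n) (t n)) a) (RtoC 0))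
        with (B (osub S (s n) (t n)) a) by ring.
      rewrite Rmult_comm. apply form_cauchy_schwarz. }
  replace l with (Cminus l (RtoC 0)) by ring.
  eapply Clim_ext; [|apply (Clim_minus _ _ _ _ Hs Hd)].
  intros n. cbv beta. rewrite form_subl. ring.
Qed.

(** Split B(d_n, d_n) as B(d_n, d_n - d_m) + B(d_n, d_m) with m fixed: the first term is small by
    Cauchy-Schwarz and boundedness, the second by the weak limit tested on d_m. *)
Lemma cauchy_weak_null d :
  CauchyFor B d -> (forall a, Clim (fun n => B (d n) a) (RtoC 0)) ->
  forall eps, 0 < eps -> exists N, forall n, (N <= n)%nat -> Re (B (d n) (d n)) < eps.
Proof.
  intros Hc Hw eps He.
  destruct (cauchy_bounded d Hc) as [M [HM [N0 H0]]].
  destruct (Hc ((eps / 2) ^ 2 / M)) as [N1 H1].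
  { apply Rdiv_lt_0_compat; auto. apply pow_lt; lra. }
  set (m := Nat.max N0 N1). destruct (Hw (d m) (eps / 2)) as [N2 H2]; [lra|].
  exists (Nat.max m N2). intros n Hn.
  specialize (H0 n ltac:(lia)). specialize (H1 n m ltac:(lia) ltac:(lia)).
  specialize (H2 n ltac:(lia)).
  replace (Cminus (B (d n) (d m)) (RtoC 0)) with (B (d n) (d m)) in H2 by ring.
  pose proof (form_cauchy_schwarz (d n) (osub S (d n) (d m))) as Hcs.
  set (y := Cmod (B (d n) (osub S (d n) (d m)))) in *.
  set (x := Re (B (osub S (d n) (d m)) (osub S (d n) (d m)))) in *.
  assert (Hx : 0 <= x) by apply (form_pos B HB).
  assert (Hy0 : 0 <= y) by apply Cmod_ge_0.
  apply (Rmult_lt_compat_r M) in H1; [|lra].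
  replace ((eps / 2) ^ 2 / M * M) with ((eps / 2) ^ 2) in H1 by (field; lra).
  pose proof (form_pos B HB (d n)) as Hp.
  assert (Hy : y < eps / 2) by (simpl in *; nra).
  pose proof (form_subr (d n) (d n) (d m)) as E. apply (f_equal Re) in E.
  pose proof (Rle_abs (Re (B (d n) (osub S (d n) (d m))))).
  pose proof (re_le_Cmod (B (d n) (osub S (d n) (d m)))). fold y in H3.
  pose proof (Rle_abs (Re (B (d n) (d m)))). pose proof (re_le_Cmod (B (d n) (d m))).
  change (Re (Cminus (B (d n) (d n)) (B (d n) (d m))))
    with (Re (B (d n) (d n)) - Re (B (d n) (d m))) in E. lra.
Qed.

(* A minimizing sequence of [N(a) - 2 Re F(a)] is Cauchy by the parallelogram law. *)
Lemma riesz (F : O -> C) (K : R) :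
  LinearFun F -> (forall a, Cmod (F a) ^ 2 <= K * Re (B a a)) ->
  exists s, CauchyFor B s /\ forall a, Clim (fun n => B (s n) a) (F a).
Proof.
  intros [FD FZ] HF. set (J := fun a => Re (B a a) - 2 * Re (F a)).
  (* The infimum of [J] is obtained as a supremum of [- J]. From |F|^2 <= |K| N and the
     arithmetic-geometric mean inequality, 2|F| <= |K| + N, hence J >= -|K|. *)
  destruct (completeness (fun y => exists a, y = - J a)) as [m' [Hub Hlub]].
  { exists (Rabs K). intros y [a ->]. unfold J.
    specialize (HF a). pose proof (re_le_Cmod (F a)). pose proof (Rle_abs (Re (F a))).
    pose proof (Cmod_ge_0 (F a)). pose proof (form_pos B HB a). pose proof (Rle_abs K).
    pose proof (Rabs_pos K). set (n := Re (B a a)) in *. set (f := Cmod (F a)) in *.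
    assert (f ^ 2 <= Rabs K * n) by nra. clear HF.
    assert (2 * f <= Rabs K + n).
    { apply Rnot_lt_le. intros Hlt.
      assert ((Rabs K + n) ^ 2 < (2 * f) ^ 2) by (simpl; nra).
      pose proof (pow2_ge_0 (Rabs K - n)). simpl in *. nra. }
    lra. }
  { exists (- J (ozero S)). now exists (ozero S). }
  set (m := - m').
  assert (Hm : forall a, m <= J a).
  { intros a. unfold m. assert (- J a <= m') by (apply Hub; now exists a). lra. }
  assert (Hs : forall n : nat, exists a, J a < m + / (INR n + 1)).
  { intros n. apply NNPP. intros Hno.
    assert (Hpos : 0 < / (INR n + 1)) by (apply Rinv_0_lt_compat; pose proof (pos_INR n); lra).
    assert (m' <= m' - / (INR n + 1)); [|lra].
    apply Hlub. intros y [a ->]. apply Rnot_lt_le. intros Hlt. apply Hno.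
    exists a. unfold m. lra. }
  apply functional_choice in Hs. destruct Hs as [s Hs]. exists s.
  assert (Hlim : is_lim_seq (fun n => / (INR n + 1)) 0).
  { apply is_lim_seq_ext with (fun n => / INR (Datatypes.S n)).
    - intros n. now rewrite S_INR.
    - apply (is_lim_seq_incr_1 (fun n => / INR n)).
      replace (Finite 0) with (Rbar_inv p_infty) by reflexivity.
      apply is_lim_seq_inv; [apply is_lim_seq_INR | discriminate]. }
  split.
  - intros eps He. assert (He4 : 0 < eps / 4) by lra.
    destruct (proj2 (is_lim_seq_spec _ _) Hlim (mkposreal _ He4)) as [N HN]. simpl in HN.
    exists N. intros i j Hi Hj.
    pose proof (HN i Hi) as Hi'. pose proof (HN j Hj) as Hj'. rewrite Rminus_0_r in Hi', Hj'.
    pose proof (Rle_abs (/ (INR i + 1))). pose proof (Rle_abs (/ (INR j + 1))).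
    pose proof (Hs i) as Hsi. pose proof (Hs j) as Hsj.
    (* Testing the infimum at the midpoint turns the parallelogram law into N(s_i - s_j) <= 2 J(s_i)
       + 2 J(s_j) - 4m, which explains eps/4. *)
    pose proof (Hm (oscal (RtoC (/ 2)) (oadd (s i) (s j)))) as Hh.
    rewrite form_parallelogram. unfold J in *.
    rewrite (form_scalr B HB), form_scall, FZ, FD in Hh.
    destruct (B (oadd (s i) (s j)) (oadd (s i) (s j))) as [w1 w2].
    destruct (F (s i)) as [f1 f2], (F (s j)) as [g1 g2]. simpl in *. lra.
  - intros a. apply Clim_of_sq_bound with (K := Re (B a a) + 1) (e := fun n => / (INR n + 1)).
    + exact Hlim.
    + intros n. specialize (Hs n). set (e := / (INR n + 1)) in *.
      pose proof (form_pos B HB a) as Ha. set (v := Re (B a a)) in *.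
      set (d := Cminus (B (s n) a) (F a)). set (t := / (v + 1)).
      assert (Ht : 0 < t) by (apply Rinv_0_lt_compat; lra).
      (* A near-minimiser is nearly stationary. Moving by -t conj(d) a gives t |d|^2 (2 - t v) <= e,
         and t = 1/(v + 1) has t v <= 1, so |d|^2 <= (v + 1) e. *)
      pose proof (Hm (oadd (s n) (oscal (Copp (Cmult (RtoC t) (Cconj d))) a))) as Hh.
      unfold J in Hh, Hs. rewrite form_quad, FD, FZ in Hh. fold v in Hh.
      rewrite Cmod_opp, Cmod_mult, Cmod_conj, Rpow_mult_distr, Cmod_R, pow2_abs in Hh.
      assert (E : Re (Cmult (Copp (Cmult (RtoC t) (Cconj d))) (B (s n) a))
                  - Re (Cmult (Copp (Cmult (RtoC t) (Cconj d))) (F a)) = - t * Cmod d ^ 2).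
      { rewrite Cmod2_alt. unfold d.
        destruct (B (s n) a) as [b1 b2], (F a) as [f1 f2]. simpl. ring. }
      change (Re (Cplus (F (s n)) (Cmult (Copp (Cmult (RtoC t) (Cconj d))) (F a))))
        with (Re (F (s n)) + Re (Cmult (Copp (Cmult (RtoC t) (Cconj d))) (F a))) in Hh.
      set (y := Cmod d ^ 2) in *. assert (Hy : 0 <= y) by (apply pow_le, Cmod_ge_0).
      assert (Hineq : 2 * t * y - t ^ 2 * y * v <= e) by lra.
      assert (Htv : t * v = 1 - t) by (unfold t; field; lra).
      replace (2 * t * y - t ^ 2 * y * v) with (t * y * (2 - t * v)) in Hineq by ring.
      rewrite Htv in Hineq.
      assert (Hty : t * y <= e) by (assert (0 <= t * y) by nra; nra).
      apply (Rmult_le_compat_l (v + 1)) in Hty; [|lra].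
      replace ((v + 1) * (t * y)) with y in Hty; [exact Hty|]. unfold t. field. lra.
Qed.

End OneForm.

(** For [B := cov] the second summand is the covariance with the operators in reverse order, so this
    is the anticommutator form. Writing it through adjoints lets one-sided facts about a sequence
    and its adjoint be combined. *)
Definition symform (B : O -> O -> C) (a b : O) : C :=
  Cmult half (Cplus (B a b) (Cconj (B (oadj a) (oadj b)))).

Lemma symform_diag B a :
  Re (symform B a a) = / 2 * (Re (B a a) + Re (B (oadj a) (oadj a))).
Proof.
  unfold symform, half. destruct (B a a), (B (oadj a) (oadj a)). simpl. field.
Qed.

Lemma symform_psd B : PSDForm B -> PSDForm (symform B).
Proof.
  intros HB. split.
  - intros a b c. unfold symform. rewrite (ax_adjD S HS), !(form_addr B HB), Cplus_conj. ring.
  - intros a k b. unfold symform. rewrite (ax_adjZ S HS), !(form_scalr B HB), Cmult_conj, Cconj_conj.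
    ring.
  - intros a b. unfold symform.
    rewrite (form_herm B HB b a), (form_herm B HB (oadj b) (oadj a)).
    unfold half. destruct (B a b), (B (oadj a) (oadj b)).
    apply injective_projections; simpl; field.
  - intros a. rewrite symform_diag. pose proof (form_pos B HB a).
    pose proof (form_pos B HB (oadj a)). lra.
Qed.

Lemma symform_diag_ge B a : PSDForm B -> Re (B a a) <= 2 * Re (symform B a a).
Proof.
  intros HB. rewrite symform_diag. pose proof (form_pos B HB (oadj a)). lra.
Qed.

Lemma symform_diag_adj B a :
  Re (symform B (oadj a) (oadj a)) = Re (symform B a a).
Proof. rewrite !symform_diag, (ax_adjK S HS). lra. Qed.

Lemma oadj_osub a b : oadj (osub S a b) = osub S (oadj a) (oadj b).
Proof.
  unfold osub. rewrite (ax_adjD S HS), (ax_adjZ S HS). do 2 f_equal.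
  unfold Cconj, RtoC; simpl. now rewrite Ropp_0.
Qed.

(** The symmetrised seminorm dominates, up to a factor 2, the one-sided one of an element and of its
    adjoint; a single vector thus provides both sides of a charge. *)
Lemma cauchy_symform B s : PSDForm B -> CauchyFor (symform B) s ->
  CauchyFor B s /\ CauchyFor B (fun n => oadj (s n)).
Proof.
  intros HB H. split; intros eps He; (destruct (H (eps / 2)) as [N HN]; [lra|]);
    exists N; intros m n Hm Hn; specialize (HN m n Hm Hn).
  - pose proof (symform_diag_ge B (osub S (s m) (s n)) HB). lra.
  - rewrite <- oadj_osub.
    pose proof (symform_diag_ge B (oadj (osub S (s m) (s n))) HB) as H1.
    rewrite symform_diag_adj in H1. lra.
Qed.

Lemma cauchy_osub B s t : PSDForm B -> CauchyFor B s -> CauchyFor B t ->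
  CauchyFor B (fun n => osub S (s n) (t n)).
Proof.
  intros HB Hs Ht eps He.
  destruct (Hs (eps / 4)) as [N1 H1]; [lra|]. destruct (Ht (eps / 4)) as [N2 H2]; [lra|].
  exists (Nat.max N1 N2). intros m n Hm Hn.
  specialize (H1 m n ltac:(lia) ltac:(lia)). specialize (H2 n m ltac:(lia) ltac:(lia)).
  pose proof (form_add_le B HB (osub S (s m) (s n)) (osub S (t n) (t m))) as H.
  replace (Re (B (osub S (osub S (s m) (t m)) (osub S (s n) (t n)))
                 (osub S (osub S (s m) (t m)) (osub S (s n) (t n)))))
    with (Re (B (oadd (osub S (s m) (s n)) (osub S (t n) (t m)))
                (oadd (osub S (s m) (s n)) (osub S (t n) (t m))))); [lra|].
  f_equal.
  rewrite ?(form_addr B HB), ?(form_addl B HB), ?(form_subl B HB), ?(form_subr B HB).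
  ring.
Qed.

End Forms.

(** * Local observables and covariances *)

Lemma least_nat (P : nat -> Prop) :
  (exists n, P n) -> exists n, P n /\ forall m, P m -> (n <= m)%nat.
Proof.
  intros [n Hn]. revert Hn. induction n as [n IH] using (well_founded_ind lt_wf). intros Hn.
  destruct (classic (exists m, P m /\ (m < n)%nat)) as [[m [Hm Hlt]]|Hno].
  - apply (IH m Hlt Hm).
  - exists n. split; auto. intros m Hm. apply Nat.nlt_ge. intros Hlt. apply Hno. now exists m.
Qed.

(** The strict drop in length is what contradicts minimality in [supp_exists]; [P] need not be
    decidable. *)
Lemma classical_filter {T : Type} (P : T -> Prop) (L : list T) :
  exists L', (forall x, In x L' <-> In x L /\ P x) /\ (length L' <= length L)%nat /\
    forall x, In x L -> ~ P x -> (length L' < length L)%nat.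
Proof.
  induction L as [|y L [L' [H1 [H2 H3]]]].
  - exists []. simpl. repeat split; try tauto; auto.
  - destruct (classic (P y)) as [Hy|Hy].
    + exists (y :: L'). split; [|split].
      * intros x. simpl. rewrite H1. intuition congruence.
      * simpl. lia.
      * intros x [<-|Hx] Hn; [contradiction|]. specialize (H3 x Hx Hn). simpl. lia.
    + exists L'. split; [|split].
      * intros x. simpl. rewrite H1. intuition congruence.
      * simpl. lia.
      * intros x _ _. simpl. lia.
Qed.

Lemma finite_enum X : finite_l X -> exists L, Enum X L.
Proof.
  intros [L HL]. exists (nodup (list_eq_dec Z.eq_dec) L). split.
  - apply NoDup_nodup.
  - intros x. rewrite nodup_In. apply HL.
Qed.

Lemma ldist_nonneg x y : (0 <= ldist x y)%Z.
Proof.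
  unfold ldist. induction (combine x y) as [|p l IH]; simpl; lia.
Qed.

Lemma min_dist_exists (X Y : lset) x y : X x -> Y y -> exists d, IsMinDist X Y d.
Proof.
  intros Hx Hy.
  destruct (least_nat (fun n => exists x y, X x /\ Y y /\ ldist x y = Z.of_nat n))
    as [n [Hn Hmin]].
  - exists (Z.to_nat (ldist x y)), x, y. pose proof (ldist_nonneg x y). repeat split; auto. lia.
  - exists (Z.of_nat n). split; auto. intros x' y' Hx' Hy'.
    pose proof (ldist_nonneg x' y').
    assert (n <= Z.to_nat (ldist x' y'))%nat; [|lia].
    apply Hmin. exists x', y'. repeat split; auto. lia.
Qed.

Section StateFacts.
Context {D : nat} (S : LatticeSystem D) (HS : LS_axioms S).
Local Notation O := (Obs S).
Local Notation loc n := (@Oloc D S (ballP D n)).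
Local Notation tr := (@otrans D S).

Lemma ballP_fin n : fin_in D (ballP D n).
Proof.
  split.
  - exists (ballL D n). intros x. symmetry. apply In_ballL.
  - intros x Hx. apply Hx.
Qed.

Lemma ballP_mono m n : (m <= n)%nat -> sub_l (ballP D m) (ballP D n).
Proof. intros H x [Hp Hx]. split; auto. lia. Qed.

Lemma loc_mono m n (a : O) : (m <= n)%nat -> loc m a -> loc n a.
Proof.
  intros H. apply (ax_loc_mono S HS); auto using ballP_fin, ballP_mono.
Qed.

Lemma loc_ozero n : loc n (ozero S).
Proof.
  unfold ozero. apply (ax_loc_scal S HS); [apply ballP_fin|].
  apply (ax_loc_mono S HS empty_l); auto using ballP_fin.
  - split; [exists []; simpl; unfold empty_l; tauto | intros y []].
  - intros y [].
  - apply (ax_loc_empty S HS). exists (RtoC 1). now rewrite (ax_scal1 S HS).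
Qed.

Lemma loc_exists (a : O) : exists n, loc n a.
Proof.
  destruct (ax_loc_union S HS a) as [X [[[L HL] HX] Ha]].
  destruct (finite_in_box D L) as [n Hn]; [intros x Hx; apply HX, HL, Hx|].
  exists (D * n)%nat. apply (ax_loc_mono S HS X); auto using ballP_fin.
  - split; auto. now exists L.
  - intros x Hx. apply In_ballL. apply (box_incl_ballL D n _ (le_n _)).
    apply (Hn n (le_n _)). now apply HL.
Qed.

(** A localising list of least length is the support: were it not contained in another localising
    set, intersecting the two would give a shorter list. *)
Lemma supp_exists n (a : O) : loc n a -> exists X, IsSupp S a X /\ sub_l X (ballP D n).
Proof.
  intros Ha.
  assert (Hfin : forall L, (forall x, In x L -> pt D x) -> fin_in D (fun x => In x L)).
  { intros L HL. split; [|exact HL]. exists L. tauto. }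
  destruct (least_nat (fun k => exists L, (forall x, In x L -> pt D x) /\
      @Oloc D S (fun x => In x L) a /\ length L = k)) as [k [[L [HL [HLa Hk]]] Hmin]].
  - exists (length (ballL D n)), (ballL D n).
    assert (HL : forall x, In x (ballL D n) -> pt D x) by (intros x Hx; apply In_ballL in Hx; apply Hx).
    split; [exact HL | split; [|reflexivity]].
    apply (ax_loc_mono S HS (ballP D n)); auto using ballP_fin. intros x. apply In_ballL.
  - assert (Hsub : forall Y, fin_in D Y -> @Oloc D S Y a -> sub_l (fun x => In x L) Y).
    { intros Y HY HYa x Hx. apply NNPP. intros Hn.
      destruct (classical_filter Y L) as [L' [H1 [_ H3]]].
      specialize (H3 x Hx Hn).
      assert (k <= length L')%nat; [|lia]. apply Hmin. exists L'.
      assert (HL' : forall x, In x L' -> pt D x) by (intros y Hy; apply HL, H1, Hy).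
      split; [exact HL' | split; [|reflexivity]].
      apply (ax_loc_mono S HS (inter_l (fun x => In x L) Y)).
      - split.
        + exists L'. intros y. symmetry. apply H1.
        + intros y [Hy _]. auto.
      - auto.
      - intros y Hy. now apply H1.
      - apply (ax_loc_inter S HS); auto. }
    exists (fun x => In x L). split.
    + split; [auto | split; auto].
    + apply Hsub; auto using ballP_fin.
Qed.

Lemma supp_adj (a : O) X : IsSupp S a X -> IsSupp S (oadj a) X.
Proof.
  intros [H1 [H2 H3]]. split; [auto | split].
  - apply (ax_loc_adj S HS); auto.
  - intros Y HY Ha. apply H3; auto. rewrite <- (ax_adjK S HS a). now apply (ax_loc_adj S HS).
Qed.

Lemma loc_adj n (a : O) : loc n a -> loc n (oadj a).
Proof. apply (ax_loc_adj S HS), ballP_fin. Qed.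

(** Translations are specified on supports, so localisation in a ball passes through the minimal
    support. *)
Lemma loc_otrans m n (a : O) x : loc m a -> pt D x -> (norm1 x <= Z.of_nat n)%Z ->
  loc (m + n) (tr x a).
Proof.
  intros Ha Hp Hx. destruct (supp_exists m a Ha) as [X [HX Hsub]].
  destruct (ax_tr_supp S HS x a X Hp HX) as [H1 [H2 _]].
  apply (ax_loc_mono S HS (shift_l X x)); auto using ballP_fin.
  intros y [z [Hz ->]]. specialize (Hsub z Hz). apply ballP_norm1 in Hsub.
  destruct Hsub as [Hpz Hz']. apply ballP_norm1. split; [now apply pt_vadd|].
  pose proof (norm1_vadd z x). lia.
Qed.

(** Translation by 0 is idempotent and injective. *)
Lemma otrans_zeros (a : O) : tr (zeros D) a = a.
Proof.
  pose proof (pt_zeros D) as Hz.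
  apply (ax_tr_inj S HS (zeros D)); auto. rewrite (ax_tr_comp S HS); auto.
  now rewrite vadd_zeros.
Qed.

Lemma onorm_nonneg (a : O) : 0 <= onorm a.
Proof.
  pose proof (ax_norm_tri S HS a (oscal (RtoC (-1)) a)) as H.
  fold (osub S a a) in H. rewrite (ax_addN S HS) in H. unfold ozero in H.
  rewrite !(ax_normZ S HS), Cmod_0, Cmod_R in H.
  replace (Rabs (-1)) with 1 in H by (rewrite Rabs_left; lra). lra.
Qed.

(** The C*-identity and submultiplicativity give |b|^2 <= |b^*| |b|; then exchange b with its
    adjoint. *)
Lemma onorm_adj (a : O) : onorm (oadj a) = onorm a.
Proof.
  assert (H : forall b : O, onorm b <= onorm (oadj b)).
  { intros b. pose proof (onorm_nonneg b). pose proof (onorm_nonneg (oadj b)).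
    pose proof (ax_normM S HS (oadj b) b) as H1. rewrite (ax_normCstar S HS) in H1. nra. }
  pose proof (H a). pose proof (H (oadj a)) as H2. rewrite (ax_adjK S HS) in H2. lra.
Qed.

(** * Covariances in a translation-invariant state *)

Variable omega : O -> C.
Hypothesis Hst : IsState S omega.

Definition cov (a b : O) : C :=
  Cminus (omega (omul (oadj a) b)) (Cmult (omega (oadj a)) (omega b)).

Lemma omega_add a b : omega (oadd a b) = Cplus (omega a) (omega b).
Proof. apply Hst. Qed.

Lemma omega_scal c a : omega (oscal c a) = Cmult c (omega a).
Proof. apply Hst. Qed.

Lemma omega_one : omega (@oone D S) = RtoC 1.
Proof. apply Hst. Qed.

Lemma omega_pos a : 0 <= Re (omega (omul (oadj a) a)) /\ Im (omega (omul (oadj a) a)) = 0.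
Proof. apply Hst. Qed.

Lemma omega_le a : Cmod (omega a) <= onorm a.
Proof. apply Hst. Qed.

Lemma omega_otrans x a : pt D x -> omega (tr x a) = omega a.
Proof. apply Hst. Qed.

Lemma oadj_one : oadj (@oone D S) = @oone D S.
Proof.
  rewrite <- (ax_mul1r S HS (oadj oone)). rewrite <- (ax_adjK S HS (omul _ _)).
  rewrite (ax_adjM S HS), (ax_adjK S HS), (ax_mul1r S HS). apply (ax_adjK S HS).
Qed.

(* Positivity of [omega ((a + k)^* (a + k))] for k = 1 and k = i fixes the
   imaginary and real parts of [omega a^*]. *)
Lemma omega_adj a : omega (oadj a) = Cconj (omega a).
Proof.
  assert (H : forall k : C,
    Im (Cplus (Cmult k (omega (oadj a))) (Cmult (Cconj k) (omega a))) = 0).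
  { intros k. destruct (omega_pos (oadd a (oscal k oone))) as [_ H].
    destruct (omega_pos a) as [_ Ha].
    rewrite (ax_adjD S HS), (ax_adjZ S HS), oadj_one, (ax_mulDl S HS), !(ax_mulDr S HS) in H.
    rewrite !(ax_mulZl S HS), !(ax_mulZr S HS), !(ax_mul1l S HS), (ax_mul1r S HS) in H.
    rewrite !omega_add, !omega_scal, omega_one in H.
    destruct (omega (omul (oadj a) a)), (omega (oadj a)), (omega a), k. simpl in *. lra. }
  pose proof (H (RtoC 1)) as H1. pose proof (H Ci) as H2.
  destruct (omega (oadj a)), (omega a). simpl in *.
  apply injective_projections; simpl; lra.
Qed.

(** Centring one factor suffices to produce the covariance, so the conditions on a pseudolocal
    sequence all become statements about [cov]. *)
Lemma omega_centered a b :
  omega (omul (oadj (osub S a (oscal (omega a) oone))) b) = cov a b.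
Proof.
  unfold osub, cov.
  rewrite (ax_adjD S HS), !(ax_adjZ S HS), oadj_one, (ax_mulDl S HS).
  rewrite !(ax_mulZl S HS), (ax_mul1l S HS).
  rewrite !omega_add, !omega_scal, omega_adj.
  destruct (omega (omul (oadj a) b)), (omega a), (omega b).
  apply injective_projections; simpl; ring.
Qed.

Lemma cov_addr a b c : cov a (oadd b c) = Cplus (cov a b) (cov a c).
Proof. unfold cov. rewrite (ax_mulDr S HS), !omega_add. ring. Qed.

Lemma cov_scalr a k b : cov a (oscal k b) = Cmult k (cov a b).
Proof. unfold cov. rewrite (ax_mulZr S HS), !omega_scal. ring. Qed.

Lemma omega_centered_sq a :
  omega (omul (oadj (osub S a (oscal (omega a) oone))) (osub S a (oscal (omega a) oone)))
  = cov a a.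
Proof.
  rewrite omega_centered. unfold osub. rewrite cov_addr, !cov_scalr.
  replace (cov a oone) with (RtoC 0); [ring|].
  unfold cov. rewrite (ax_mul1r S HS), omega_one. ring.
Qed.

Lemma cov_psd : PSDForm S cov.
Proof.
  split; auto using cov_addr, cov_scalr.
  - intros a b. unfold cov. rewrite Cminus_conj, Cmult_conj, <- !omega_adj.
    rewrite (ax_adjM S HS), !(ax_adjK S HS). ring.
  - intros a. rewrite <- omega_centered_sq. apply omega_pos.
Qed.

Lemma anticomm_symcov u b :
  Cminus (Cmult half (omega (anticomm S (oadj u) b))) (Cmult (omega (oadj u)) (omega b))
  = symform S cov u b.
Proof.
  unfold symform, anticomm, cov.
  rewrite Cminus_conj, Cmult_conj, <- !omega_adj.
  rewrite (ax_adjM S HS), !(ax_adjK S HS), omega_add.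
  unfold half. destruct (omega (oadj u)), (omega b), (omega (omul (oadj u) b)),
    (omega (omul b (oadj u))).
  apply injective_projections; simpl; field.
Qed.

Lemma cov_bound a b : Cmod (cov a b) <= 2 * onorm a * onorm b.
Proof.
  unfold cov, Cminus. eapply Rle_trans; [apply Cmod_triangle|].
  rewrite Cmod_opp, Cmod_mult.
  pose proof (omega_le (omul (oadj a) b)) as H1. pose proof (omega_le (oadj a)) as H2.
  pose proof (omega_le b) as H3. pose proof (ax_normM S HS (oadj a) b) as H4.
  rewrite onorm_adj in *. pose proof (Cmod_ge_0 (omega (oadj a))).
  pose proof (Cmod_ge_0 (omega b)). nra.
Qed.

Lemma cov_otrans x a b : pt D x -> cov (tr x a) (tr x b) = cov a b.
Proof.
  intros Hx. unfold cov.
  rewrite <- (ax_tr_adj S HS), <- (ax_tr_mul S HS), !omega_otrans; auto.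
Qed.

Lemma cov_otrans_diff x y a b : pt D x -> pt D y ->
  cov (tr x a) (tr y b) = cov (tr (vadd x (vneg y)) a) b.
Proof.
  intros Hx Hy.
  rewrite <- (cov_otrans y (tr (vadd x (vneg y)) a) b Hy).
  rewrite (ax_tr_comp S HS); auto using pt_vadd, pt_vneg.
  now rewrite vadd_comm, (vadd_vnegK D).
Qed.

Lemma cov_scalar_l k b : cov (oscal k oone) b = RtoC 0.
Proof.
  rewrite (form_scall S cov cov_psd). replace (cov oone b) with (RtoC 0); [ring|].
  unfold cov. rewrite oadj_one, (ax_mul1l S HS), omega_one. ring.
Qed.

Lemma cov_scalar_r a k : cov a (oscal k oone) = RtoC 0.
Proof.
  rewrite (form_herm S cov cov_psd), cov_scalar_l. unfold Cconj, RtoC; simpl. now rewrite Ropp_0.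
Qed.

End StateFacts.

(** * Decay of covariances under translation *)

Section Clustering.
Context {D : nat} (HD : (1 <= D)%nat) (S : LatticeSystem D) (HS : LS_axioms S).
Local Notation O := (Obs S).
Local Notation loc n := (@Oloc D S (ballP D n)).
Local Notation tr := (@otrans D S).

(** Covers the case of infinite distance: an empty support has no minimal distance to anything, but
    covariances with scalars vanish. *)
Lemma supp_empty_scalar (a : O) X :
  IsSupp S a X -> ~ (exists x, X x) -> exists k, a = oscal k oone.
Proof.
  intros [HX [Ha _]] Hne. apply (ax_loc_empty S HS).
  apply (ax_loc_mono S HS X); auto.
  - split; [exists []; simpl; tauto | intros x []].
  - intros x Hx. apply Hne. now exists x.
Qed.

Lemma Rpower_neg_antitone p x y : 0 < p -> 0 < x -> x <= y -> Rpower y (- p) <= Rpower x (- p).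
Proof.
  intros Hp Hx Hxy. rewrite !Rpower_Ropp. apply Rinv_le_contravar; [apply exp_pos|].
  apply Rle_Rpower_l; lra.
Qed.

Lemma enum_length_le X L M : Enum X L -> (forall x, X x -> In x M) -> (length L <= length M)%nat.
Proof.
  intros [HN HL] H. apply NoDup_incl_length; auto. intros x Hx. apply H, HL, Hx.
Qed.

(** For small translations the trivial bound 2|a||b| suffices, as the weight is bounded below there.
    For large ones the supports are far apart and clustering applies. The constant depends only on
    the radius [r]. *)
Lemma cov_decay (omega : O -> C) : ClusteringState S omega ->
  exists q, 1 < q /\ forall r, exists K, 0 < K /\ forall a b x,
    loc r a -> loc r b -> pt D x ->
    Cmod (cov S omega (tr x a) b) <= K * onorm a * onorm b * wt q x.
Proof.
  intros [Hst [nu [f [p [Hnu [_ [HDp [Hf Hcl]]]]]]]].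
  assert (HDpos : 1 <= INR D) by (apply (le_INR 1); exact HD).
  assert (Hq : 1 < p / INR D).
  { apply (Rmult_lt_reg_r (INR D)); [lra|]. replace (p / INR D * INR D) with p by (field; lra). lra. }
  exists (p / INR D). split; [exact Hq|].
  (* The successor is needed because clustering asks for supports of size strictly below [l]. [K1]
     serves the near regime and [K2] the far one. *)
  intros r. set (l := Datatypes.S (length (ballL D r))).
  set (K1 := 2 * Rpower (1 + 4 * INR r) p). set (K2 := nu l * Rpower 2 p).
  assert (HK1 : 0 < K1) by (apply Rmult_lt_0_compat; [lra | apply exp_pos]).
  assert (HK2 : 0 < K2) by (apply Rmult_lt_0_compat; [auto | apply exp_pos]).
  exists (K1 + K2). split; [lra|]. intros a b x Ha Hb Hx.
  pose proof (onorm_nonneg S HS a) as Hna. pose proof (onorm_nonneg S HS b) as Hnb.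
  assert (Hnab : 0 <= onorm a * onorm b) by nra.
  set (N := IZR (norm1 x)).
  assert (HN : 0 <= N) by (apply IZR_le, norm1_nonneg).
  pose proof (pos_INR r) as Hr.
  assert (Hwt : Rpower (1 + N) (- p) <= wt (p / INR D) x).
  { pose proof (wt_lower (p / INR D) Hq x N (Rle_refl _)) as H. rewrite Hx in H.
    replace (p / INR D * INR D) with p in H by (field; lra). exact H. }
  pose proof (wt_pos (p / INR D) x) as Hw0.
  assert (HP : 0 <= onorm a * onorm b * wt (p / INR D) x) by (apply Rmult_le_pos; lra).
  rewrite Rmult_assoc in HP.
  (* Beyond 4r the distance d >= |x| - 2r satisfies 2d >= 1 + |x|, so f(d) costs only the factor
     2^p. *)
  destruct (Z_le_gt_dec (norm1 x) (4 * Z.of_nat r)) as [Hle|Hgt].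
  - apply Rle_trans with (K1 * onorm a * onorm b * wt (p / INR D) x); [|rewrite !Rmult_assoc; nra].
    eapply Rle_trans; [apply (cov_bound S HS omega Hst)|].
    rewrite (ax_tr_norm S HS); auto.
    apply IZR_le in Hle. rewrite mult_IZR, <- INR_IZR_INZ in Hle. fold N in Hle.
    pose proof (Rpower_neg_antitone p (1 + N) (1 + 4 * INR r) ltac:(lra) ltac:(lra) ltac:(lra)) as H.
    assert (E : Rpower (1 + 4 * INR r) p * Rpower (1 + 4 * INR r) (- p) = 1).
    { rewrite <- Rpower_plus, Rplus_opp_r, Rpower_O; lra. }
    assert (H1 : 1 <= Rpower (1 + 4 * INR r) p * wt (p / INR D) x).
    { eapply Rle_trans; [right; symmetry; exact E|].
      apply Rmult_le_compat_l; [left; apply exp_pos | lra]. }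
    replace (K1 * onorm a * onorm b * wt (p / INR D) x)
      with (2 * (onorm a * onorm b) * (Rpower (1 + 4 * INR r) p * wt (p / INR D) x))
      by (unfold K1; ring). nra.
  - apply Rle_trans with (K2 * onorm a * onorm b * wt (p / INR D) x); [|rewrite !Rmult_assoc; nra].
    destruct (supp_exists S HS r a Ha) as [X [HX HXs]].
    destruct (supp_exists S HS r b Hb) as [Y [HY HYs]].
    assert (Hzero : Cmod (RtoC 0) <= K2 * onorm a * onorm b * wt (p / INR D) x).
    { rewrite Cmod_0. replace (K2 * onorm a * onorm b * wt (p / INR D) x)
        with (K2 * (onorm a * onorm b) * wt (p / INR D) x) by ring.
      apply Rmult_le_pos; [apply Rmult_le_pos|]; lra. }
    destruct (classic (exists z, X z)) as [[z Hz]|Hne].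
    2:{ destruct (supp_empty_scalar a X HX Hne) as [k ->].
        rewrite (ax_tr_scal S HS), (ax_tr_one S HS), (cov_scalar_l S HS omega Hst); auto. }
    destruct (classic (exists z, Y z)) as [[y Hy]|Hne].
    2:{ destruct (supp_empty_scalar b Y HY Hne) as [k ->].
        rewrite (cov_scalar_r S HS omega Hst); auto. }
    assert (HX' : IsSupp S (oadj (tr x a)) (shift_l X x)).
    { apply supp_adj; auto. apply (ax_tr_supp S HS); auto. }
    destruct (min_dist_exists (shift_l X x) Y (vadd z x) y) as [d Hd];
      [now exists z | auto |].
    destruct HX' as [[Hfx Hpx] HXr]. destruct HY as [[Hfy Hpy] HYr].
    destruct (finite_enum _ Hfx) as [LX HLX]. destruct (finite_enum _ Hfy) as [LY HLY].
    assert (HlX : (length LX < l)%nat).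
    { unfold l. rewrite <- (length_map (fun z => vadd z x) (ballL D r)).
      apply Nat.lt_succ_r. eapply enum_length_le; [exact HLX|].
      intros w [z' [Hz' ->]]. apply in_map_iff. exists z'. split; auto. now apply In_ballL, HXs. }
    assert (HlY : (length LY < l)%nat).
    { unfold l. apply Nat.lt_succ_r. eapply enum_length_le; [exact HLY|].
      intros w Hw. now apply In_ballL, HYs. }
    pose proof (Hcl l (oadj (tr x a)) b _ _ LX LY d (conj (conj Hfx Hpx) HXr)
                  (conj (conj Hfy Hpy) HYr) HLX HLY HlX HlY Hd) as H.
    rewrite (onorm_adj S HS), (ax_tr_norm S HS) in H; auto.
    fold (cov S omega (tr x a) b) in H. eapply Rle_trans; [exact H|]. clear H.
    assert (HdN : (norm1 x - 2 * Z.of_nat r <= d)%Z).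
    { destruct Hd as [[x' [y' [[z' [Hz' ->]] [Hy' <-]]]] _].
      pose proof (HXs z' Hz') as Hz1. pose proof (HYs y' Hy') as Hy1.
      apply ballP_norm1 in Hz1, Hy1. destruct Hz1 as [Hz1 Hz2], Hy1 as [Hy1 Hy2].
      pose proof (ldist_shift_lower D z' x y' Hz1 Hx Hy1). lia. }
    assert (HdN' : (1 + N) / 2 <= IZR d).
    { assert (H : (1 + norm1 x <= 2 * d)%Z) by lia. apply IZR_le in H.
      rewrite plus_IZR, mult_IZR in H. fold N in H. lra. }
    assert (Hfd : f d <= Rpower 2 p * wt (p / INR D) x).
    { eapply Rle_trans; [apply Hf; lia|].
      eapply Rle_trans; [apply (Rpower_neg_antitone p ((1 + N) / 2)); lra|].
      replace (Rpower ((1 + N) / 2) (- p)) with (Rpower 2 p * Rpower (1 + N) (- p)).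
      - apply Rmult_le_compat_l; [left; apply exp_pos | exact Hwt].
      - unfold Rpower. rewrite <- exp_plus, (ln_div (1 + N) 2) by lra. f_equal. ring. }
    replace (K2 * onorm a * onorm b * wt (p / INR D) x)
      with (nu l * onorm a * onorm b * (Rpower 2 p * wt (p / INR D) x)) by (unfold K2; ring).
    apply Rmult_le_compat_l; auto.
    rewrite Rmult_assoc. apply Rmult_le_pos; [left; apply Hnu | exact Hnab].
Qed.

End Clustering.

(** * The summed covariance *)

Lemma bernoulli_le t d : 0 <= t <= 1 -> 1 - INR d * t <= (1 - t) ^ d.
Proof.
  intros Ht. induction d as [|d IH]; [simpl; lra|].
  rewrite S_INR. simpl.
  assert (0 <= (1 - t) ^ d <= 1).
  { split; [apply pow_le; lra|]. pose proof (pow_incr (1 - t) 1 d ltac:(lra)) as H. now rewrite pow1 in H. }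
  assert (t * (1 - t) ^ d <= t) by nra. lra.
Qed.

Lemma nat_above (x : R) : exists N, forall n, (N <= n)%nat -> x <= INR n.
Proof.
  destruct (INR_unbounded x) as [N HN]. exists N. intros n Hn. apply le_INR in Hn. lra.
Qed.

Lemma INR_length_box d n : INR (length (box d n)) = (2 * INR n + 1) ^ d.
Proof. rewrite length_box, pow_INR, plus_INR, mult_INR. reflexivity. Qed.

(** Folner property of boxes: by Bernoulli's inequality a layer of fixed width m has relative volume
    at most d t, with t = 2m/(2n + 1). *)
Lemma box_boundary_small d m eps : 0 < eps -> exists N, forall n, (N <= n)%nat ->
  (m <= n)%nat /\
  INR (length (box d n)) - INR (length (box d (n - m))) <= eps * INR (length (box d n)).
Proof.
  intros He. destruct (nat_above (INR d * INR m / eps)) as [N HN].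
  exists (Nat.max N m). intros n Hn. split; [lia|].
  specialize (HN n ltac:(lia)). rewrite !INR_length_box, minus_INR by lia.
  assert (Hmn : INR m <= INR n) by (apply le_INR; lia).
  pose proof (pos_INR m). pose proof (pos_INR d).
  set (t := 2 * INR m / (2 * INR n + 1)).
  assert (Ht : t * (2 * INR n + 1) = 2 * INR m) by (unfold t; field; lra).
  replace (2 * (INR n - INR m) + 1) with ((1 - t) * (2 * INR n + 1)) by lra.
  rewrite Rpow_mult_distr.
  assert (Ht01 : 0 <= t <= 1) by (split; nra).
  pose proof (bernoulli_le t d Ht01).
  assert (HP : 0 < (2 * INR n + 1) ^ d) by (apply pow_lt; lra).
  assert (Hdt : INR d * t <= eps).
  { apply (Rmult_le_compat_r eps) in HN; [|lra].
    replace (INR d * INR m / eps * eps) with (INR d * INR m) in HN by (field; lra).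
    apply (Rmult_le_reg_r (2 * INR n + 1)); [lra|].
    rewrite Rmult_assoc, Ht. nra. }
  nra.
Qed.

(** [jf n] is the largest j <= n whose threshold [Nf j] is at most n, found by minimising n - j;
    before [Nf 0] its value is arbitrary. *)
Lemma diagonal_index (P : nat -> nat -> Prop) :
  (forall j, exists N, forall n, (N <= n)%nat -> P j n) ->
  exists jf : nat -> nat,
    (forall J, exists N, forall n, (N <= n)%nat -> (J <= jf n)%nat) /\
    exists N0, forall n, (N0 <= n)%nat -> P (jf n) n.
Proof.
  intros H. apply functional_choice in H. destruct H as [Nf HN].
  assert (Hj : forall n, exists j, (Nf 0%nat <= n)%nat ->
    (Nf j <= n)%nat /\ forall i, (i <= n)%nat -> (Nf i <= n)%nat -> (i <= j)%nat).
  { intros n. destruct (Nat.le_gt_cases (Nf 0%nat) n) as [Hn|Hn]; [|exists 0%nat; lia].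
    destruct (least_nat (fun k => exists j, (j + k = n)%nat /\ (Nf j <= n)%nat))
      as [k [[j [Hjk Hj]] Hmin]].
    - exists n, 0%nat. split; auto.
    - exists j. intros _. split; auto. intros i Hi HNi.
      assert (k <= n - i)%nat; [|lia]. apply Hmin. exists i. split; auto. lia. }
  apply functional_choice in Hj. destruct Hj as [jf Hjf]. exists jf. split.
  - intros J. exists (Nat.max (Nf 0%nat) (Nat.max J (Nf J))). intros n Hn.
    destruct (Hjf n) as [_ H]; [lia|]. apply H; lia.
  - exists (Nf 0%nat). intros n Hn. destruct (Hjf n Hn) as [H _]. now apply HN.
Qed.

Lemma is_lim_seq_inv_S (j : nat -> nat) :
  (forall J, exists N, forall n, (N <= n)%nat -> (J <= j n)%nat) ->
  is_lim_seq (fun n => / (INR (j n) + 1)) 0.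
Proof.
  intros Hj. apply is_lim_seq_spec. intros eps.
  destruct (nat_above (/ eps)) as [J HJ]. destruct (Hj J) as [N HN].
  exists N. intros n Hn. specialize (HJ (j n) (HN n Hn)).
  pose proof (Rinv_0_lt_compat _ (cond_pos eps)) as He. pose proof (cond_pos eps) as He0.
  rewrite Rminus_0_r, Rabs_pos_eq; [|apply Rlt_le, Rinv_0_lt_compat; lra].
  rewrite <- (Rinv_inv eps). apply Rinv_lt_contravar; nra.
Qed.

Section LimitForm.
Context {D : nat} (S : LatticeSystem D) (HS : LS_axioms S).
Local Notation O := (Obs S).
Local Notation loc n := (@Oloc D S (ballP D n)).
Local Notation tr := (@otrans D S).
Variable omega : O -> C.
Hypothesis Hst : IsState S omega.
Local Notation cov := (cov S omega).
Variable q : R.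
Hypothesis Hq : 1 < q.
Hypothesis Hdecay : forall r, exists K, 0 < K /\ forall a b x,
  loc r a -> loc r b -> pt D x ->
  Cmod (cov (tr x a) b) <= K * onorm a * onorm b * wt q x.
Local Notation tail := (wtail q Hq D).

(** One-sided counterpart of [bra], summed along boxes, which suit the weight, whereas [bra] uses
    balls; unconditional convergence makes the exhaustions agree. *)
Definition Lform (a b : O) : C :=
  (real (Lim_seq (fun n => Re (csum (fun x => cov (tr x a) b) (box D n)))),
   real (Lim_seq (fun n => Im (csum (fun x => cov (tr x a) b) (box D n))))).

Lemma box_pt n x : In x (box D n) -> pt D x.
Proof. intros H. apply In_box in H. apply H. Qed.

Lemma Clim_real_Lim_seq u l :
  Clim u l -> (real (Lim_seq (fun n => Re (u n))), real (Lim_seq (fun n => Im (u n)))) = l.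
Proof.
  intros H. rewrite (is_lim_seq_unique _ _ (Clim_Re _ _ H)), (is_lim_seq_unique _ _ (Clim_Im _ _ H)).
  now destruct l.
Qed.

Lemma Clim_of_tail u l K (L : nat -> list (list Z)) :
  (forall n, Cmod (Cminus (u n) l) <= K * tail (L n)) ->
  is_lim_seq (fun n => tail (L n)) 0 -> Clim u l.
Proof.
  intros H HL. apply (Clim_squeeze u (fun _ => l) l (fun n => K * tail (L n))).
  - apply Clim_const.
  - replace (Finite 0) with (Rbar_mult K 0) by (simpl; f_equal; ring).
    now apply is_lim_seq_scal_l.
  - now exists 0%nat.
Qed.

(** One constant per radius, with the summation set entering only through its tail: the first allows
    the diagonal choice, the second allows shifted boxes. *)
Lemma Lform_remainder r : exists K, 0 < K /\ forall a b L, loc r a -> loc r b ->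
  (forall x, In x L -> pt D x) -> NoDup L ->
  Cmod (Cminus (csum (fun x => cov (tr x a) b) L) (Lform a b)) <= K * onorm a * onorm b * tail L.
Proof.
  destruct (Hdecay r) as [K [HK Hdec]]. exists K. split; auto. intros a b L Ha Hb HL HN.
  destruct (weighted_sum_limit q Hq D (fun x => cov (tr x a) b) (K * onorm a * onorm b))
    as [l Hl]; [intros; now apply Hdec|].
  replace (Lform a b) with l; [now apply Hl|]. symmetry. apply Clim_real_Lim_seq.
  apply Clim_of_tail with (K := K * onorm a * onorm b) (L := box D).
  - intros n. apply Hl; [apply box_pt | apply NoDup_box].
  - apply wtail_box_lim.
Qed.

Lemma loc_common (a b : O) : exists r, loc r a /\ loc r b.
Proof.
  destruct (loc_exists S HS a) as [m Hm]. destruct (loc_exists S HS b) as [n Hn].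
  exists (Nat.max m n). split; [apply (loc_mono S HS m) | apply (loc_mono S HS n)]; auto; lia.
Qed.

Lemma Lform_lim a b (L : nat -> list (list Z)) :
  (forall n x, In x (L n) -> pt D x) -> (forall n, NoDup (L n)) ->
  is_lim_seq (fun n => tail (L n)) 0 ->
  Clim (fun n => csum (fun x => cov (tr x a) b) (L n)) (Lform a b).
Proof.
  intros HL HN Ht. destruct (loc_common a b) as [r [Ha Hb]].
  destruct (Lform_remainder r) as [K [_ HK]].
  apply Clim_of_tail with (K := K * onorm a * onorm b) (L := L); [|exact Ht].
  intros n. apply HK; auto. exact (HL n).
Qed.

Lemma Lform_lim_box a b :
  Clim (fun n => csum (fun x => cov (tr x a) b) (box D n)) (Lform a b).
Proof.
  apply Lform_lim; [apply box_pt | apply NoDup_box | apply wtail_box_lim].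
Qed.

Lemma cov_otrans_flip a b x : pt D x -> cov (tr x a) b = Cconj (cov (tr (vneg x) b) a).
Proof.
  intros Hx. rewrite (form_herm S cov (cov_psd S HS omega Hst)). f_equal.
  rewrite <- (otrans_zeros S HS b) at 1.
  rewrite (cov_otrans_diff S HS omega Hst); auto using pt_zeros.
  now rewrite vadd_comm, vadd_zeros by now apply pt_vneg.
Qed.

(** * Sums of translates over boxes *)

Definition Tsum (M : list (list Z)) (a : O) : O :=
  fold_right (fun x acc => oadd (tr x a) acc) (ozero S) M.

Lemma form_Tsum_r (B : O -> O -> C) a b M : PSDForm S B ->
  B a (Tsum M b) = csum (fun x => B a (tr x b)) M.
Proof.
  intros HB. unfold Tsum, csum. induction M as [|x M IH]; simpl.
  - unfold ozero. rewrite (form_scalr S B HB). ring.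
  - now rewrite (form_addr S B HB), IH.
Qed.

Lemma form_Tsum_l (B : O -> O -> C) a b M : PSDForm S B ->
  B (Tsum M a) b = csum (fun x => B (tr x a) b) M.
Proof.
  intros HB. rewrite (form_herm S B HB), (form_Tsum_r B b a M HB), <- csum_conj.
  apply csum_ext. intros x _. symmetry. apply (form_herm S B HB).
Qed.

Lemma oadj_Tsum M a : (forall x, In x M -> pt D x) -> oadj (Tsum M a) = Tsum M (oadj a).
Proof.
  unfold Tsum. induction M as [|x M IH]; simpl; intros HM.
  - unfold ozero. rewrite (ax_adjZ S HS), (oadj_one S HS). f_equal.
    unfold Cconj, RtoC; simpl. now rewrite Ropp_0.
  - rewrite (ax_adjD S HS), IH by auto. rewrite (ax_tr_adj S HS); auto.
Qed.

Lemma loc_Tsum m n M a : loc m a ->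
  (forall x, In x M -> pt D x /\ (norm1 x <= Z.of_nat n)%Z) -> loc (m + n) (Tsum M a).
Proof.
  intros Ha. unfold Tsum. induction M as [|x M IH]; simpl; intros HM.
  - apply (loc_ozero S HS).
  - apply (ax_loc_add S HS); auto using ballP_fin.
    destruct (HM x (or_introl eq_refl)). now apply loc_otrans.
Qed.

(** By invariance, translating [b] amounts to shifting the summation set, so the result is a partial
    sum of [Lform a b] with a controlled tail. *)
Lemma cov_Tsum_otrans M a b y : pt D y -> (forall x, In x M -> pt D x) ->
  cov (Tsum M a) (tr y b)
  = csum (fun x => cov (tr x a) b) (map (fun x => vadd x (vneg y)) M).
Proof.
  intros Hy HM. rewrite (form_Tsum_l cov _ _ _ (cov_psd S HS omega Hst)), csum_map.
  apply csum_ext. intros x Hx. apply (cov_otrans_diff S HS omega Hst); auto.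
Qed.

Lemma shifted_box_pt n y x : pt D y ->
  In x (map (fun x => vadd x (vneg y)) (box D n)) -> pt D x.
Proof.
  intros Hy Hx. apply in_map_iff in Hx. destruct Hx as [z [<- Hz]].
  apply box_pt in Hz. now apply pt_vadd, pt_vneg.
Qed.

Lemma NoDup_shifted_box n y : pt D y ->
  NoDup (map (fun x => vadd x (vneg y)) (box D n)).
Proof.
  intros Hy. apply (NoDup_map_vadd D); auto using pt_vneg, NoDup_box. intros x. apply box_pt.
Qed.

Lemma shifted_box_incl m k n y : (m + k <= n)%nat -> In y (box D k) ->
  incl (box D m) (map (fun x => vadd x (vneg y)) (box D n)).
Proof.
  intros Hmk Hy x Hx. apply in_map_iff. exists (vadd x y). split.
  - apply (vadd_vnegK' D); eapply box_pt; eauto.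
  - apply (box_incl D (m + k)); auto. now apply box_vadd.
Qed.

Lemma tail_nonneg_box n : 0 <= tail (box D n).
Proof. apply wtail_nonneg; [intros x; apply box_pt | apply NoDup_box]. Qed.

Lemma tail_box_small eps : 0 < eps -> exists N, forall n, (N <= n)%nat -> tail (box D n) < eps.
Proof.
  intros He. destruct (proj2 (is_lim_seq_spec _ _) (wtail_box_lim q Hq D) (mkposreal _ He)) as [N HN].
  simpl in HN. exists N. intros n Hn. specialize (HN n Hn). rewrite Rminus_0_r in HN.
  pose proof (Rle_abs (tail (box D n))). lra.
Qed.

(** Covariances of box sums grow like the volume. For y at depth m in the box, the box shifted by -y
    still contains the box of size m and has small tail; the other y form a boundary layer, whose
    tails are only bounded by [wtot] but whose volume fraction vanishes. Each part costs eps/2. *)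
Lemma cov_average a b eps : 0 < eps -> exists N, forall n, (N <= n)%nat ->
  Cmod (Cminus (cov (Tsum (box D n) a) (Tsum (box D n) b))
               (Cmult (RtoC (INR (length (box D n)))) (Lform a b)))
  <= eps * INR (length (box D n)).
Proof.
  intros He. destruct (loc_common a b) as [r [Ha Hb]].
  destruct (Lform_remainder r) as [K0 [HK0 Hrem]].
  set (K := K0 * onorm a * onorm b).
  assert (HK : 0 <= K).
  { unfold K. pose proof (onorm_nonneg S HS a). pose proof (onorm_nonneg S HS b).
    apply Rmult_le_pos; [apply Rmult_le_pos|]; lra. }
  assert (HW : 0 <= wtot q Hq D).
  { pose proof (wtail_le_wtot q Hq D (box D 0)). pose proof (tail_nonneg_box 0). lra. }
  destruct (tail_box_small (eps / (2 * (K + 1)))) as [m Hm].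
  { apply Rdiv_lt_0_compat; lra. }
  specialize (Hm m (le_n _)).
  destruct (box_boundary_small D m (eps / (2 * (K * wtot q Hq D + 1)))) as [N HN].
  { apply Rdiv_lt_0_compat; [lra|]. assert (0 <= K * wtot q Hq D) by (now apply Rmult_le_pos). lra. }
  exists N. intros n Hn. destruct (HN n Hn) as [Hmn Hbd]. clear HN.
  rewrite (form_Tsum_r cov _ _ _ (cov_psd S HS omega Hst)).
  rewrite <- csum_const.
  replace (Cminus (csum (fun x => cov (Tsum (box D n) a) (tr x b)) (box D n))
                  (csum (fun _ => Lform a b) (box D n)))
    with (csum (fun y => Cminus (cov (Tsum (box D n) a) (tr y b)) (Lform a b)) (box D n)).
  2:{ unfold Cminus. rewrite csum_plus. f_equal. rewrite !csum_const. ring. }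
  eapply Rle_trans.
  { apply Cmod_csum_le with
      (h := fun y => K * tail (map (fun x => vadd x (vneg y)) (box D n))).
    intros y Hy. pose proof (box_pt _ _ Hy) as Hpy.
    rewrite cov_Tsum_otrans; auto; [|intros x; apply box_pt].
    apply Hrem; auto using NoDup_shifted_box. intros x. now apply shifted_box_pt. }
  rewrite rsum_scal.
  (* [R] is the boundary layer. *)
  destruct (NoDup_incl_split (box D (n - m)) (box D n)) as [R HR];
    auto using NoDup_box; [apply box_incl; lia|].
  pose proof (Permutation_length HR) as Hlen. rewrite length_app in Hlen.
  apply (f_equal INR) in Hlen. rewrite plus_INR in Hlen.
  rewrite (rsum_perm _ _ _ HR), rsum_app.
  assert (H1 : rsum (fun y => tail (map (fun x => vadd x (vneg y)) (box D n))) (box D (n - m))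
               <= INR (length (box D (n - m))) * tail (box D m)).
  { rewrite <- rsum_const. apply rsum_le. intros y Hy.
    apply wtail_incl; [apply NoDup_box | apply NoDup_shifted_box; eapply box_pt; eauto |].
    apply (shifted_box_incl m (n - m)); auto. lia. }
  assert (H2 : rsum (fun y => tail (map (fun x => vadd x (vneg y)) (box D n))) R
               <= INR (length R) * wtot q Hq D).
  { rewrite <- rsum_const. apply rsum_le. intros y Hy. apply wtail_le_wtot. }
  set (B := INR (length (box D n))) in *. set (B' := INR (length (box D (n - m)))) in *.
  set (E := INR (length R)) in *. set (W := wtot q Hq D) in *.
  set (t := tail (box D m)) in *.
  assert (HB' : 0 <= B') by apply pos_INR. assert (HE : 0 <= E) by apply pos_INR.
  assert (Ht : 0 <= t) by apply tail_nonneg_box.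
  assert (Hb1 : K * t <= eps / 2).
  { apply Rlt_le in Hm. apply (Rmult_le_compat_l (K + 1)) in Hm; [|lra].
    replace ((K + 1) * (eps / (2 * (K + 1)))) with (eps / 2) in Hm by (field; lra). nra. }
  assert (HKW : 0 <= K * W) by (now apply Rmult_le_pos).
  assert (Hb2 : K * W * E <= eps / 2 * B).
  { replace E with (B - B') by lra.
    apply (Rmult_le_compat_l (K * W + 1)) in Hbd; [|lra].
    replace ((K * W + 1) * (eps / (2 * (K * W + 1)) * B)) with (eps / 2 * B) in Hbd
      by (field; lra).
    assert (0 <= B - B') by lra. nra. }
  apply Rle_trans with (K * (B' * t + E * W)).
  { apply Rmult_le_compat_l; lra. }
  assert (B' * (K * t) <= B * (eps / 2)) by (apply Rmult_le_compat; nra).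
  nra.
Qed.

Lemma Lform_psd : PSDForm S Lform.
Proof.
  pose proof (cov_psd S HS omega Hst) as Hc. split.
  - intros a b c. eapply Clim_unique; [apply Lform_lim_box|].
    eapply Clim_ext; [|apply (Clim_plus _ _ _ _ (Lform_lim_box a b) (Lform_lim_box a c))].
    intros n. cbv beta. rewrite <- csum_plus. apply csum_ext. intros x _.
    symmetry. apply (form_addr S cov Hc).
  - intros a k b. eapply Clim_unique; [apply Lform_lim_box|].
    eapply Clim_ext; [|apply (Clim_scal k _ _ (Lform_lim_box a b))].
    intros n. cbv beta. rewrite <- csum_scal. apply csum_ext. intros x _.
    symmetry. apply (form_scalr S cov Hc).
  - intros a b. eapply Clim_unique; [apply Lform_lim_box|].
    eapply Clim_ext; [|apply (Clim_conj _ _ (Lform_lim_box b a))].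
    intros n. cbv beta. rewrite <- csum_conj.
    (* Hermitian symmetry exchanges x and -x, and boxes are symmetric under reflection. *)
    assert (HP : Permutation (map vneg (box D n)) (box D n)).
    { apply NoDup_Permutation; [|apply NoDup_box|].
      - apply NoDup_map_NoDup_ForallPairs; [|apply NoDup_box]. intros x y _ _ E.
        rewrite <- (vneg_involutive x), <- (vneg_involutive y). now rewrite E.
      - intros x. rewrite in_map_iff. split.
        + intros [y [<- Hy]]. now apply box_vneg.
        + intros Hx. exists (vneg x). split; [apply vneg_involutive | now apply box_vneg]. }
    rewrite <- (csum_perm _ _ _ HP), csum_map. apply csum_ext. intros x Hx.
    symmetry. apply cov_otrans_flip. eapply box_pt; eauto.
  (* A negative value would, by the volume law with half its size as error, make the variance of a
     large box sum negative. *)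
  - intros a. apply Rnot_lt_le. intros Hlt.
    destruct (cov_average a a (- Re (Lform a a) / 2)) as [N HN]; [lra|].
    specialize (HN N (le_n _)). pose proof (INR_length_box_pos D N) as HB.
    set (B := INR (length (box D N))) in *.
    pose proof (form_pos S cov Hc (Tsum (box D N) a)) as Hp.
    set (v := cov (Tsum (box D N) a) (Tsum (box D N) a)) in *.
    pose proof (re_le_Cmod (Cminus v (Cmult (RtoC B) (Lform a a)))) as H1.
    pose proof (Rle_abs (Re (Cminus v (Cmult (RtoC B) (Lform a a))))) as H2.
    assert (E : Re (Cminus v (Cmult (RtoC B) (Lform a a))) = Re v - B * Re (Lform a a)).
    { destruct v, (Lform a a). simpl. ring. }
    nra.
Qed.

Lemma bra_term_symcov a b x : pt D x ->
  bra_term S omega a b x = symform S cov (tr x a) b.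
Proof.
  intros Hx. rewrite <- (anticomm_symcov S HS omega Hst). unfold bra_term.
  now rewrite <- (ax_tr_adj S HS), (omega_otrans S omega Hst).
Qed.

Lemma tail_ballL_lim : is_lim_seq (fun n => tail (ballL D n)) 0.
Proof.
  apply is_lim_seq_spec. intros eps. destruct (tail_box_small eps (cond_pos eps)) as [N HN].
  exists (D * N)%nat. intros n Hn. rewrite Rminus_0_r, Rabs_pos_eq.
  - eapply Rle_lt_trans; [|apply (HN N (le_n _))].
    apply wtail_incl; auto using NoDup_box, NoDup_ballL. now apply box_incl_ballL.
  - apply wtail_nonneg; [|apply NoDup_ballL]. intros x Hx. apply In_ballL in Hx. apply Hx.
Qed.

(** Balls contain large boxes, so their tails vanish too; the adjoint term of [symform] supplies the
    reverse operator order inside the anticommutator. *)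
Lemma bra_symform a b : bra S omega a b = symform S Lform a b.
Proof.
  unfold bra. apply Clim_real_Lim_seq.
  assert (Hpt : forall n x, In x (ballL D n) -> pt D x).
  { intros n x Hx. apply In_ballL in Hx. apply Hx. }
  pose proof (Lform_lim a b (ballL D) Hpt (NoDup_ballL D) tail_ballL_lim) as H1.
  pose proof (Lform_lim (oadj a) (oadj b) (ballL D) Hpt (NoDup_ballL D) tail_ballL_lim) as H2.
  eapply Clim_ext; [|apply (Clim_scal half _ _ (Clim_plus _ _ _ _ H1 (Clim_conj _ _ H2)))].
  intros n. cbv beta. rewrite <- csum_conj, <- csum_plus, <- csum_scal.
  unfold bra_partial. fold (csum (bra_term S omega a b) (ballL D n)).
  apply csum_ext. intros x Hx. rewrite bra_term_symcov by eauto.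
  unfold symform. rewrite (ax_tr_adj S HS); eauto.
Qed.

Lemma bra_psd : PSDForm S (bra S omega).
Proof.
  destruct (symform_psd S HS Lform Lform_psd) as [H1 H2 H3 H4].
  split; intros; rewrite !bra_symform; auto.
Qed.

Lemma symcov_average a eps : 0 < eps -> exists N, forall n, (N <= n)%nat ->
  Re (symform S cov (Tsum (box D n) a) (Tsum (box D n) a))
  <= INR (length (box D n)) * (sqn S omega a + eps).
Proof.
  intros He. destruct (cov_average a a eps He) as [N1 H1].
  destruct (cov_average (oadj a) (oadj a) eps He) as [N2 H2].
  exists (Nat.max N1 N2). intros n Hn.
  specialize (H1 n ltac:(lia)). specialize (H2 n ltac:(lia)).
  unfold sqn. rewrite bra_symform, !symform_diag, oadj_Tsum by (intros x; apply box_pt).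
  set (B := INR (length (box D n))) in *.
  assert (Hre : forall v w, Cmod (Cminus v (Cmult (RtoC B) w)) <= eps * B ->
                       Re v <= B * Re w + eps * B).
  { intros v w H. pose proof (re_le_Cmod (Cminus v (Cmult (RtoC B) w))).
    pose proof (Rle_abs (Re (Cminus v (Cmult (RtoC B) w)))).
    assert (Re (Cminus v (Cmult (RtoC B) w)) = Re v - B * Re w).
    { destruct v, w. simpl. ring. }
    lra. }
  apply Hre in H1, H2. lra.
Qed.

(** * Pseudolocal charges *)

Hypothesis HD : (1 <= D)%nat.

Definition CovPseudolocal (Q : nat -> O) : Prop :=
  (forall n, loc n (Q n)) /\
  (exists gamma, 0 < gamma /\ forall n, (0 < n)%nat ->
     Re (cov (Q n) (Q n)) <= gamma * INR n ^ D) /\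
  (forall a, exists l, Clim (fun n => cov (Q n) a) l) /\
  (exists k, 0 < k < 1 /\ forall a eps, 0 < eps -> exists N, forall n, (N <= n)%nat ->
     forall x y, pt D x -> pt D y ->
     IZR (norm1 x) <= k * INR n -> IZR (norm1 y) <= k * INR n ->
     Cmod (Cminus (cov (Q n) (tr x a)) (cov (Q n) (tr y a))) <= eps).

Lemma pseudolocal_cov Q : Pseudolocal S omega Q <-> CovPseudolocal Q.
Proof.
  unfold Pseudolocal, CovPseudolocal, Qp.
  pose proof (omega_centered S HS omega Hst) as E1.
  pose proof (omega_centered_sq S HS omega Hst) as E2.
  split; intros [H1 [[g [Hg H2]] [H3 [k [Hk H4]]]]]; (split; [exact H1 | split; [|split]]).
  - exists g. split; auto. intros n Hn. rewrite <- E2. auto.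
  - intros a. destruct (H3 a) as [l Hl]. exists l. apply Clim_filterlim in Hl.
    eapply Clim_ext; [|exact Hl]. intros n. apply E1.
  - exists k. split; auto. intros a eps He. destruct (H4 a eps He) as [N HN].
    exists N. intros n Hn x y Hx Hy Hx' Hy'. rewrite <- !E1.
    apply HN; auto; rewrite ldist_zeros; auto.
  - exists g. split; auto. intros n Hn. rewrite E2. auto.
  - intros a. destruct (H3 a) as [l Hl]. exists l. apply Clim_filterlim.
    eapply Clim_ext; [|exact Hl]. intros n. symmetry. apply E1.
  - exists k. split; auto. intros a eps He. destruct (H4 a eps He) as [N HN].
    exists N. intros n Hn x y Hx Hy Hx' Hy'. rewrite !E1.
    rewrite ldist_zeros in Hx', Hy' by auto. auto.
Qed.

Lemma charge_symcov F : IsCharge S omega F <->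
  exists Q, CovPseudolocal Q /\ CovPseudolocal (fun n => oadj (Q n)) /\
    forall a, Clim (fun n => symform S cov (Q n) a) (F a).
Proof.
  unfold IsCharge. split; intros [Q [H1 [H2 H3]]]; exists Q; rewrite !pseudolocal_cov in *;
    (split; [exact H1 | split; [exact H2|]]); intros a.
  - eapply Clim_ext; [|apply Clim_filterlim, H3]. intros n. apply (anticomm_symcov S HS omega Hst).
  - apply Clim_filterlim. eapply Clim_ext; [|apply H3]. intros n. symmetry. apply (anticomm_symcov S HS omega Hst).
Qed.

(** * Charges are bounded by the seminorm *)

Lemma Cmod_half : Cmod half = / 2.
Proof. unfold half. rewrite Cmod_R, Rabs_pos_eq; lra. Qed.

Lemma symform_diff_le (B : O -> O -> C) u a b e :
  Cmod (Cminus (B u a) (B u b)) <= e ->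
  Cmod (Cminus (B (oadj u) (oadj a)) (B (oadj u) (oadj b))) <= e ->
  Cmod (Cminus (symform S B u a) (symform S B u b)) <= e.
Proof.
  intros H1 H2. unfold symform.
  replace (Cminus (Cmult half (Cplus (B u a) (Cconj (B (oadj u) (oadj a)))))
                  (Cmult half (Cplus (B u b) (Cconj (B (oadj u) (oadj b))))))
    with (Cmult half (Cplus (Cminus (B u a) (B u b))
            (Cconj (Cminus (B (oadj u) (oadj a)) (B (oadj u) (oadj b))))))
    by (rewrite Cminus_conj; ring).
  rewrite Cmod_mult, Cmod_half.
  pose proof (Cmod_triangle (Cminus (B u a) (B u b))
    (Cconj (Cminus (B (oadj u) (oadj a)) (B (oadj u) (oadj b))))) as H.
  rewrite Cmod_conj in H. lra.
Qed.

(** The powers of the volume B balance: the pairing with a box sum is about B V(Q_n, a), while the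
    two variances are at most K B and B (N + e), so B^2 cancels. *)
Lemma charge_bounded F : IsCharge S omega F ->
  LinearFun S F /\ exists K, forall a, Cmod (F a) ^ 2 <= K * sqn S omega a.
Proof.
  intros HF. apply charge_symcov in HF.
  destruct HF as [Q [[_ [[g1 [Hg1 HI1]] [_ [k1 [Hk1 HIII1]]]]]
                   [[_ [[g2 [Hg2 HI2]] [_ [k2 [Hk2 HIII2]]]]] HF]]].
  pose proof (symform_psd S HS cov (cov_psd S HS omega Hst)) as HV.
  set (V := symform S cov) in *.
  split.
  { split.
    - intros a b. eapply Clim_unique; [apply HF|].
      eapply Clim_ext; [|apply (Clim_plus _ _ _ _ (HF a) (HF b))].
      intros n. symmetry. apply (form_addr S V HV).
    - intros k a. eapply Clim_unique; [apply HF|].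
      eapply Clim_ext; [|apply (Clim_scal k _ _ (HF a))].
      intros n. symmetry. apply (form_scalr S V HV). }
  set (k := Rmin k1 k2). set (g := g1 + g2).
  assert (Hk : 0 < k) by (apply Rmin_glb_lt; lra).
  assert (Hkl : k <= k1) by apply Rmin_l. assert (Hkr : k <= k2) by apply Rmin_r.
  assert (HDpos : 1 <= INR D) by (apply (le_INR 1); exact HD).
  (* With m the integer part of kn/D, n is at most (D/k)(2m + 1), so n^D is at most (D/k)^D times
     the volume of the box. *)
  set (K := g * (INR D / k) ^ D).
  assert (HK : 0 <= K).
  { apply Rmult_le_pos; [unfold g; lra|]. apply pow_le. apply Rlt_le, Rdiv_lt_0_compat; lra. }
  exists (2 * K). intros a.
  set (N := sqn S omega a).
  assert (HN : 0 <= N) by apply (form_pos S _ bra_psd).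
  (* From |F(a)| <= v + 2e and v^2 <= K (N + e): (v + 2e)^2 <= 2v^2 + 8e^2, and e^2 <= e. The error
     e is sent to 0 at the end. *)
  assert (Heps : forall e, 0 < e <= 1 -> Cmod (F a) ^ 2 <= 2 * K * N + (8 + 2 * K) * e).
  { intros e He.
    destruct (symcov_average a e) as [M HM]; [lra|].
    destruct (HF a e) as [n1 Hn1]; [lra|].
    destruct (HIII1 a e) as [n2 Hn2]; [lra|].
    destruct (HIII2 (oadj a) e) as [n3 Hn3]; [lra|].
    destruct (nat_above ((INR M + 1) * INR D / k)) as [n4 Hn4].
    set (n := Nat.max 1 (Nat.max n1 (Nat.max n2 (Nat.max n3 n4)))).
    specialize (Hn1 n ltac:(lia)). specialize (Hn2 n ltac:(lia)).
    specialize (Hn3 n ltac:(lia)). specialize (Hn4 n ltac:(lia)).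
    assert (Hn : 0 < INR n) by (apply lt_0_INR; lia).
    assert (Hkn : INR M + 1 <= k * INR n / INR D).
    { apply (Rmult_le_compat_l (k / INR D)) in Hn4; [|apply Rlt_le, Rdiv_lt_0_compat; lra].
      replace (k / INR D * ((INR M + 1) * INR D / k)) with (INR M + 1) in Hn4 by (field; lra).
      replace (k * INR n / INR D) with (k / INR D * INR n) by (field; lra). exact Hn4. }
    (* A box of half-side kn/D lies in the ball of radius kn where (III) applies; the extra 1 in
       [Hkn] absorbs the rounding, so that m >= M. *)
    destruct (nfloor_ex (k * INR n / INR D)) as [m [Hm1 Hm2]]; [pose proof (pos_INR M); lra|].
    assert (HMm : (M <= m)%nat) by (apply INR_le; lra).
    specialize (HM m HMm). fold V N in HM.
    set (L := box D m) in *. set (B := INR (length L)) in *.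
    assert (HB : 0 < B) by apply INR_length_box_pos.
    assert (HLk : forall x, In x L -> pt D x /\ IZR (norm1 x) <= k * INR n).
    { intros x Hx. split; [eapply box_pt; eauto|].
      pose proof (norm1_box _ _ _ Hx) as H. apply IZR_le in H.
      rewrite <- INR_IZR_INZ, mult_INR in H.
      apply (Rmult_le_compat_l (INR D)) in Hm1; [|lra].
      replace (INR D * (k * INR n / INR D)) with (k * INR n) in Hm1 by (field; lra). lra. }
    assert (Hz : IZR (norm1 (zeros D)) <= k * INR n).
    { rewrite norm1_zeros. nra. }
    assert (Hinv : forall x, In x L -> Cmod (Cminus (V (Q n) (tr x a)) (V (Q n) a)) <= e).
    { intros x Hx. destruct (HLk x Hx) as [Hp Hxn].
      apply symform_diff_le.
      - specialize (Hn2 x (zeros D) Hp (pt_zeros D)).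
        rewrite (otrans_zeros S HS) in Hn2. apply Hn2; nra.
      - specialize (Hn3 x (zeros D) Hp (pt_zeros D)).
        rewrite (otrans_zeros S HS), (ax_tr_adj S HS) in Hn3 by auto. apply Hn3; nra. }
    assert (Havg : Cmod (Cminus (V (Q n) (Tsum L a)) (Cmult (RtoC B) (V (Q n) a))) <= B * e).
    { rewrite (form_Tsum_r V _ _ _ HV). unfold B. rewrite <- csum_const, <- rsum_const.
      replace (Cminus (csum (fun x => V (Q n) (tr x a)) L) (csum (fun _ => V (Q n) a) L))
        with (csum (fun x => Cminus (V (Q n) (tr x a)) (V (Q n) a)) L).
      - now apply Cmod_csum_le.
      - unfold Cminus. rewrite csum_plus. f_equal. rewrite !csum_const. ring. }
    assert (HVQ : Re (V (Q n) (Q n)) <= g * INR n ^ D).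
    { unfold V. rewrite symform_diag. specialize (HI1 n ltac:(lia)). specialize (HI2 n ltac:(lia)).
      cbv beta in HI2. unfold g. pose proof (pow_lt (INR n) D Hn). nra. }
    assert (HnB : INR n ^ D <= (INR D / k) ^ D * B).
    { unfold B, L. rewrite INR_length_box, <- Rpow_mult_distr. apply pow_incr. split; [lra|].
      apply (Rmult_lt_compat_l (INR D / k)) in Hm2; [|apply Rdiv_lt_0_compat; lra].
      replace (INR D / k * (k * INR n / INR D)) with (INR n) in Hm2 by (field; lra).
      eapply Rlt_le, Rlt_le_trans; [exact Hm2|].
      apply Rmult_le_compat_l; [apply Rlt_le, Rdiv_lt_0_compat; lra|].
      pose proof (pos_INR m). lra. }
    pose proof (form_cauchy_schwarz S V HV (Q n) (Tsum L a)) as Hcs.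
    set (w := Cmod (V (Q n) (Tsum L a))) in *.
    assert (Hw0 : 0 <= w) by apply Cmod_ge_0.
    assert (HVQ' : Re (V (Q n) (Q n)) <= K * B).
    { unfold K. eapply Rle_trans; [exact HVQ|]. rewrite Rmult_assoc.
      apply Rmult_le_compat_l; [unfold g; lra | exact HnB]. }
    assert (Hw : w ^ 2 <= K * (N + e) * B ^ 2).
    { eapply Rle_trans; [exact Hcs|].
      replace (K * (N + e) * B ^ 2) with ((K * B) * (B * (N + e))) by ring.
      apply Rmult_le_compat; auto; apply (form_pos S V HV). }
    set (v := w / B).
    assert (Hv0 : 0 <= v) by (apply Rdiv_le_0_compat; lra).
    assert (Hv : v ^ 2 <= K * (N + e)).
    { unfold v. apply (Rmult_le_reg_r (B ^ 2)); [apply pow_lt; lra|].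
      replace ((w / B) ^ 2 * B ^ 2) with (w ^ 2) by (field; lra). exact Hw. }
    assert (Hva : Cmod (V (Q n) a) <= v + e).
    { apply (Rmult_le_reg_l B); [lra|].
      replace (B * (v + e)) with (w + B * e) by (unfold v; field; lra).
      replace (B * Cmod (V (Q n) a)) with (Cmod (Cmult (RtoC B) (V (Q n) a)))
        by (rewrite Cmod_mult, Cmod_R, Rabs_pos_eq; lra).
      pose proof (Cmod_triangle (V (Q n) (Tsum L a))
        (Copp (Cminus (V (Q n) (Tsum L a)) (Cmult (RtoC B) (V (Q n) a))))) as H.
      rewrite Cmod_opp in H.
      replace (Cplus (V (Q n) (Tsum L a))
        (Copp (Cminus (V (Q n) (Tsum L a)) (Cmult (RtoC B) (V (Q n) a)))))
        with (Cmult (RtoC B) (V (Q n) a)) in H by ring.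
      fold w in H. lra. }
    assert (HFa : Cmod (F a) <= v + 2 * e).
    { pose proof (Cmod_triangle (V (Q n) a) (Copp (Cminus (V (Q n) a) (F a)))) as H.
      rewrite Cmod_opp in H.
      replace (Cplus (V (Q n) a) (Copp (Cminus (V (Q n) a) (F a)))) with (F a) in H by ring.
      lra. }
    pose proof (Cmod_ge_0 (F a)).
    assert (Cmod (F a) ^ 2 <= (v + 2 * e) ^ 2) by (apply pow_incr; lra).
    pose proof (pow2_ge_0 (v - 2 * e)). simpl in *. nra. }
  apply Rnot_lt_le. intros Hlt.
  set (gap := Cmod (F a) ^ 2 - 2 * K * N) in *.
  assert (Hgap : 0 < gap) by (unfold gap; lra).
  assert (Hc : 0 < 8 + 2 * K) by lra.
  set (e := Rmin 1 (gap / (2 * (8 + 2 * K)))).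
  assert (He0 : 0 < e).
  { apply Rmin_glb_lt; [lra|]. apply Rdiv_lt_0_compat; lra. }
  assert (He1 : e <= 1) by apply Rmin_l.
  assert (He2 : (8 + 2 * K) * e <= gap / 2).
  { assert (H : e <= gap / (2 * (8 + 2 * K))) by apply Rmin_r.
    apply (Rmult_le_compat_l (8 + 2 * K)) in H; [|lra].
    replace ((8 + 2 * K) * (gap / (2 * (8 + 2 * K)))) with (gap / 2) in H by (field; lra).
    exact H. }
  specialize (Heps e (conj He0 He1)). unfold gap in *. lra.
Qed.

(** * Charges built from Cauchy sequences *)

Lemma box_length_le_pow n : (0 < n)%nat -> INR (length (box D (n / 2 / D))) <= 3 ^ D * INR n ^ D.
Proof.
  intros Hn. rewrite INR_length_box, <- Rpow_mult_distr. apply pow_incr.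
  assert (H1 : (n / 2 / D <= n / 2)%nat) by (apply Nat.Div0.div_le_upper_bound; nia).
  assert (H2 : (2 * (n / 2) <= n)%nat) by apply Nat.Div0.mul_div_le.
  assert (H : (2 * (n / 2 / D) + 1 <= 3 * n)%nat) by lia.
  apply le_INR in H. rewrite plus_INR, !mult_INR in H.
  replace (INR 1) with 1 in H by reflexivity.
  replace (INR 2) with 2 in H by (simpl; ring).
  replace (INR 3) with 3 in H by (simpl; ring).
  pose proof (pos_INR (n / 2 / D)). lra.
Qed.

(** Translations of length at most n/2 leave radius n/2 for the summand. Below [N0] the box is
    empty, so that Q_n = 0: localisation and (I) are demanded at small n too, where the diagonal
    choice guarantees nothing. *)
Definition supporting_box (N0 n : nat) : list (list Z) :=
  if Nat.leb N0 n then box D (n / 2 / D) else [].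

Lemma supporting_box_pt N0 n x : In x (supporting_box N0 n) -> pt D x.
Proof.
  unfold supporting_box. destruct (Nat.leb N0 n); [apply box_pt | intros []].
Qed.

(** Shifting the box of size n/2/D by a point of the box of size n/4/D leaves a set containing the
    latter box. Hence all pairings of Q_n with such translates of [a] are within [e n] of the same
    number [Lform (t n) a], which yields (II) and (III) together. *)
Lemma pseudolocal_of_local_sums (t : nat -> O) (N0 : nat) :
  let Q := fun n => Tsum (supporting_box N0 n) (t n) in
  (forall n, (N0 <= n)%nat -> loc (n / 2) (t n)) ->
  (exists M, 0 < M /\ forall n, (N0 <= n)%nat ->
     Re (cov (Q n) (Q n)) <= M * INR (length (box D (n / 2 / D)))) ->
  (forall a, exists e : nat -> R, is_lim_seq e 0 /\ exists N, forall n, (N <= n)%nat ->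
     forall L, (forall x, In x L -> pt D x) -> NoDup L -> incl (box D (n / 4 / D)) L ->
     Cmod (Cminus (csum (fun x => cov (tr x (t n)) a) L) (Lform (t n) a)) <= e n) ->
  (forall a, exists l, Clim (fun n => Lform (t n) a) l) ->
  CovPseudolocal Q /\
  forall a l, Clim (fun n => Lform (t n) a) l -> Clim (fun n => cov (Q n) a) l.
Proof.
  intros Q Hloc [M [HM HI]] Hsum Hlim.
  assert (Hest : forall a, exists e : nat -> R, is_lim_seq e 0 /\ exists N, forall n, (N <= n)%nat ->
    forall y, In y (box D (n / 4 / D)) ->
    Cmod (Cminus (cov (Q n) (tr y a)) (Lform (t n) a)) <= e n).
  { intros a. destruct (Hsum a) as [e [He [N HN]]]. exists e. split; auto.
    exists (Nat.max N N0). intros n Hn y Hy. pose proof (box_pt _ _ Hy) as Hpy.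
    unfold Q, supporting_box. rewrite (proj2 (Nat.leb_le N0 n)) by lia.
    rewrite cov_Tsum_otrans; auto; [|intros x; apply box_pt].
    apply HN; [lia | intros x; now apply shifted_box_pt | now apply NoDup_shifted_box |].
    assert (Hdiv : (n / 4 / D + n / 4 / D <= n / 2 / D)%nat).
    { apply Nat.div_le_lower_bound; [lia|].
      pose proof (Nat.Div0.mul_div_le (n / 4) D). pose proof (Nat.Div0.mul_div_le n 4).
      assert (2 * (n / 4) <= n / 2)%nat by (apply Nat.div_le_lower_bound; lia). nia. }
    now apply (shifted_box_incl (n / 4 / D) (n / 4 / D)). }
  assert (Hcv : forall a l, Clim (fun n => Lform (t n) a) l -> Clim (fun n => cov (Q n) a) l).
  { intros a l Hl. destruct (Hest a) as [e [He [N HN]]].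
    apply (Clim_squeeze _ (fun n => Lform (t n) a) l e); auto. exists N. intros n Hn.
    rewrite <- (otrans_zeros S HS a) at 1. apply HN; auto.
    apply pt_in_box; [apply pt_zeros|]. rewrite norm1_zeros. lia. }
  split; [|exact Hcv].
  split; [|split; [|split]].
  - intros n. unfold Q, supporting_box. destruct (Nat.leb_spec N0 n) as [Hn|Hn].
    + apply (loc_mono S HS (n / 2 + n / 2)).
      * pose proof (Nat.Div0.mul_div_le n 2). lia.
      * apply loc_Tsum; [now apply Hloc|]. intros x Hx. split; [eapply box_pt; eauto|].
        pose proof (norm1_box _ _ _ Hx). pose proof (Nat.Div0.mul_div_le (n / 2) D). lia.
    + apply (loc_ozero S HS).
  - exists (M * 3 ^ D). assert (H3 : 0 < 3 ^ D) by (apply pow_lt; lra).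
    split; [nra|]. intros n Hn. pose proof (box_length_le_pow n Hn) as Hb.
    destruct (Nat.le_gt_cases N0 n) as [Hn0|Hn0].
    + eapply Rle_trans; [now apply HI|]. rewrite Rmult_assoc. apply Rmult_le_compat_l; lra.
    + unfold Q, supporting_box. rewrite (proj2 (Nat.leb_gt N0 n)) by lia.
      rewrite (form_Tsum_r cov _ _ _ (cov_psd S HS omega Hst)). unfold csum; simpl.
      assert (0 <= INR n ^ D) by apply pow_le, pos_INR. apply Rmult_le_pos; nra.
  - intros a. destruct (Hlim a) as [l Hl]. exists l. auto.
  - assert (HDpos : 1 <= INR D) by (apply (le_INR 1); exact HD).
    (* An integer norm at most n/(4D) is at most n/4/D in integer division, so these translations
       lie in the box of [Hest]. *)
    exists (/ (4 * INR D)). split.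
    { split; [apply Rinv_0_lt_compat; lra|]. rewrite <- Rinv_1. apply Rinv_lt_contravar; lra. }
    intros a eps Heps. destruct (Hest a) as [e [He [N HN]]].
    assert (He2 : 0 < eps / 2) by lra.
    destruct (proj2 (is_lim_seq_spec _ _) He (mkposreal _ He2)) as [N1 HN1]. simpl in HN1.
    exists (Nat.max N N1). intros n Hn x y Hx Hy Hxn Hyn.
    specialize (HN1 n ltac:(lia)). rewrite Rminus_0_r in HN1. pose proof (Rle_abs (e n)).
    assert (Hin : forall z, pt D z -> IZR (norm1 z) <= / (4 * INR D) * INR n ->
                    In z (box D (n / 4 / D))).
    { intros z Hz Hzn. apply pt_in_box; auto. pose proof (norm1_nonneg z) as Hz0.
      apply (Rmult_le_compat_l (4 * INR D)) in Hzn; [|lra].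
      rewrite <- Rmult_assoc, Rinv_r, Rmult_1_l in Hzn by lra.
      rewrite !INR_IZR_INZ, <- !mult_IZR in Hzn. apply le_IZR in Hzn.
      assert (Z.to_nat (norm1 z) <= n / 4 / D)%nat; [|lia].
      rewrite Nat.Div0.div_div. apply Nat.div_le_lower_bound; [lia|]. nia. }
    pose proof (HN n ltac:(lia) x (Hin x Hx Hxn)) as Hx'.
    pose proof (HN n ltac:(lia) y (Hin y Hy Hyn)) as Hy'.
    replace (Cminus (cov (Q n) (tr x a)) (cov (Q n) (tr y a)))
      with (Cplus (Cminus (cov (Q n) (tr x a)) (Lform (t n) a))
                  (Copp (Cminus (cov (Q n) (tr y a)) (Lform (t n) a)))) by ring.
    eapply Rle_trans; [apply Cmod_triangle|]. rewrite Cmod_opp. lra.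
Qed.

Lemma quarter_box_tail_small eps : 0 < eps -> exists N, forall n, (N <= n)%nat ->
  tail (box D (n / 4 / D)) < eps.
Proof.
  intros He. destruct (tail_box_small eps He) as [N HN]. exists (4 * D * N)%nat.
  intros n Hn. apply HN. rewrite Nat.Div0.div_div. apply Nat.div_le_lower_bound; lia.
Qed.

(* Surjectivity: sum the translates of [s_j] over a box of side proportional to
   [n], with [j = j(n)] growing slowly enough that the box already resolves [s_j]
   against every [A] of norm at most [j] supported in the ball of radius [j]. *)
Lemma cauchy_charge s : CauchyFor S (bra S omega) s ->
  exists F, IsCharge S omega F /\ forall a, Clim (fun n => bra S omega (s n) a) (F a).
Proof.
  intros Hs.
  assert (HsL : CauchyFor S (symform S Lform) s).
  { intros eps He. destruct (Hs eps He) as [N HN]. exists N. intros m n Hm Hn.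
    rewrite <- bra_symform. now apply HN. }
  destruct (cauchy_symform S HS Lform s Lform_psd HsL) as [Hs1 Hs2].
  destruct (cauchy_bounded S _ bra_psd s Hs) as [M [HM [NM HNM]]].
  destruct (functional_choice _ (fun j => loc_exists S HS (s j))) as [r Hr].
  destruct (functional_choice _ Lform_remainder) as [Kf HKf].
  (* One ball containing both s_j and any A localised in the ball of radius j. *)
  set (rad := fun j => Nat.max (r j) j).
  set (T := fun j n => Tsum (box D (n / 2 / D)) (s j)).
  (* The factor [INR j] stands for the norm of A. The boundedness of s is only known from [NM] on;
     the last disjunct makes the predicate hold for smaller j and is ruled out once [jf n >= NM]. *)
  destruct (diagonal_index (fun j n => (NM <= j)%nat /\ (r j <= n / 2)%nat /\
      Kf (rad j) * onorm (s j) * INR j * tail (box D (n / 4 / D)) <= / (INR j + 1) /\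
      Re (symform S cov (T j n) (T j n))
        <= INR (length (box D (n / 2 / D))) * (sqn S omega (s j) + 1) \/ (j < NM)%nat))
    as [jf [Hjf [N1 HN1]]].
  { intros j. set (c := Kf (rad j) * onorm (s j) * INR j).
    assert (Hc : 0 <= c).
    { destruct (HKf (rad j)) as [HK _]. pose proof (onorm_nonneg S HS (s j)). pose proof (pos_INR j).
      apply Rmult_le_pos; [apply Rmult_le_pos|]; lra. }
    destruct (Nat.le_gt_cases NM j) as [HNMj|HNMj]; [|exists 0%nat; intros; right; lia].
    assert (Hpj : 0 < / (INR j + 1)) by (apply Rinv_0_lt_compat; pose proof (pos_INR j); lra).
    destruct (quarter_box_tail_small (/ (INR j + 1) / (c + 1))) as [n1 Hn1];
      [apply Rdiv_lt_0_compat; lra|].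
    destruct (symcov_average (s j) 1 Rlt_0_1) as [n2 Hn2].
    exists (Nat.max (2 * r j) (Nat.max n1 (2 * D * n2))). intros n Hn. left.
    split; [exact HNMj | split; [|split]].
    - apply Nat.div_le_lower_bound; lia.
    - specialize (Hn1 n ltac:(lia)). fold c.
      pose proof (tail_nonneg_box (n / 4 / D)).
      apply (Rmult_lt_compat_l (c + 1)) in Hn1; [|lra].
      replace ((c + 1) * (/ (INR j + 1) / (c + 1))) with (/ (INR j + 1)) in Hn1
        by (field; pose proof (pos_INR j); split; lra). nra.
    - apply Hn2. rewrite Nat.Div0.div_div. apply Nat.div_le_lower_bound; lia. }
  destruct (Hjf NM) as [N2 HN2]. set (N0 := Nat.max N1 N2).
  assert (HP : forall n, (N0 <= n)%nat -> (NM <= jf n)%nat /\ (r (jf n) <= n / 2)%nat /\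
      Kf (rad (jf n)) * onorm (s (jf n)) * INR (jf n) * tail (box D (n / 4 / D))
        <= / (INR (jf n) + 1) /\
      Re (symform S cov (T (jf n) n) (T (jf n) n))
        <= INR (length (box D (n / 2 / D))) * (sqn S omega (s (jf n)) + 1)).
  { intros n Hn. specialize (HN2 n ltac:(lia)). destruct (HN1 n ltac:(lia)) as [H|H]; [exact H|lia]. }
  set (Q := fun n => Tsum (supporting_box N0 n) (s (jf n))).
  assert (HQT : forall n, (N0 <= n)%nat -> Q n = T (jf n) n).
  { intros n Hn. unfold Q, supporting_box. now rewrite (proj2 (Nat.leb_le N0 n)). }
  assert (HQadj : forall n, oadj (Q n) = Tsum (supporting_box N0 n) (oadj (s (jf n)))).
  { intros n. apply oadj_Tsum. apply supporting_box_pt. }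
  assert (HvarQ : forall n, (N0 <= n)%nat ->
     Re (symform S cov (Q n) (Q n)) <= (M + 1) * INR (length (box D (n / 2 / D)))).
  { intros n Hn. rewrite (HQT n Hn). destruct (HP n Hn) as [H1 [_ [_ H2]]].
    specialize (HNM _ H1). fold (sqn S omega (s (jf n))) in HNM.
    pose proof (INR_length_box_pos D (n / 2 / D)). nra. }
  pose proof (cov_psd S HS omega Hst) as Hcov.
  (* Adjoints have the same radii and norms, so one diagonal index serves both s and its adjoint
     sequence. *)
  assert (Hrem : forall t : nat -> O,
    (forall j, loc (r j) (t j)) -> (forall j, onorm (t j) = onorm (s j)) ->
    forall a, exists e : nat -> R, is_lim_seq e 0 /\ exists N, forall n, (N <= n)%nat ->
     forall L, (forall x, In x L -> pt D x) -> NoDup L -> incl (box D (n / 4 / D)) L ->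
     Cmod (Cminus (csum (fun x => cov (tr x (t (jf n))) a) L) (Lform (t (jf n)) a)) <= e n).
  { intros t Ht Htn a. exists (fun n => / (INR (jf n) + 1)).
    split; [now apply is_lim_seq_inv_S|].
    destruct (loc_exists S HS a) as [ra Hra]. destruct (nat_above (onorm a)) as [na Hna].
    destruct (Hjf (Nat.max ra na)) as [N3 HN3].
    exists (Nat.max N0 N3). intros n Hn L HL HLN Hi.
    specialize (HN3 n ltac:(lia)). specialize (Hna (jf n) ltac:(lia)).
    destruct (HP n ltac:(lia)) as [_ [_ [Hsmall _]]].
    destruct (HKf (rad (jf n))) as [HK HKb].
    eapply Rle_trans; [apply HKb; auto|].
    - apply (loc_mono S HS (r (jf n))); auto. unfold rad; lia.
    - apply (loc_mono S HS ra); auto. unfold rad; lia.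
    - eapply Rle_trans; [|exact Hsmall]. rewrite Htn.
      pose proof (onorm_nonneg S HS (s (jf n))). pose proof (onorm_nonneg S HS a).
      assert (H1 : tail L <= tail (box D (n / 4 / D))) by (apply wtail_incl; auto using NoDup_box).
      assert (H2 : 0 <= tail L) by (apply wtail_nonneg; auto).
      assert (H3 : 0 <= Kf (rad (jf n)) * onorm (s (jf n))) by (apply Rmult_le_pos; lra).
      apply Rmult_le_compat; auto; [apply Rmult_le_pos; lra|].
      apply Rmult_le_compat_l; auto. }
  assert (Hlim : forall t : nat -> O, CauchyFor S Lform t ->
    forall a, exists l, Clim (fun n => Lform (t (jf n)) a) l).
  { intros t Ht a. destruct (cauchy_pairing_cvg S Lform Lform_psd t a Ht) as [l Hl].
    exists l. now apply (Clim_subseq (fun j => Lform (t j) a)). }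
  destruct (pseudolocal_of_local_sums (fun n => s (jf n)) N0) as [HQ1 HQ2].
  { intros n Hn. destruct (HP n Hn) as [_ [H _]]. now apply (loc_mono S HS (r (jf n))). }
  { exists (2 * (M + 1)). split; [lra|]. intros n Hn. fold (Q n).
    pose proof (symform_diag_ge S cov (Q n) Hcov). specialize (HvarQ n Hn). lra. }
  { now apply Hrem. }
  { now apply (Hlim s). }
  destruct (pseudolocal_of_local_sums (fun n => oadj (s (jf n))) N0) as [HQ3 HQ4].
  { intros n Hn. destruct (HP n Hn) as [_ [H _]].
    now apply (loc_mono S HS (r (jf n))), loc_adj. }
  { exists (2 * (M + 1)). split; [lra|]. intros n Hn. rewrite <- HQadj.
    pose proof (symform_diag_ge S cov (oadj (Q n)) Hcov) as H.
    rewrite (symform_diag_adj S HS) in H. specialize (HvarQ n Hn). lra. }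
  { apply (Hrem (fun j => oadj (s j))).
    - intros j. now apply loc_adj.
    - intros j. apply (onorm_adj S HS). }
  { apply (Hlim (fun j => oadj (s j)) Hs2). }
  fold Q in HQ1, HQ2.
  destruct (functional_choice _ (fun a => cauchy_pairing_cvg S (bra S omega) bra_psd s a Hs))
    as [F HF].
  exists F. split; [|exact HF]. apply charge_symcov. exists Q.
  split; [exact HQ1 | split].
  - rewrite (functional_extensionality _ _ HQadj). exact HQ3.
  - intros a.
    destruct (cauchy_pairing_cvg S Lform Lform_psd s a Hs1) as [l1 Hl1].
    destruct (cauchy_pairing_cvg S Lform Lform_psd _ (oadj a) Hs2) as [l2 Hl2].
    (* The two one-sided limits give the value of the charge of Q, and [bra_symform] gives the same
       value for the pairings of s. *)
    replace (F a) with (Cmult half (Cplus l1 (Cconj l2))).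
    + unfold symform. apply Clim_scal, Clim_plus; [|apply Clim_conj].
      * apply HQ2. now apply (Clim_subseq (fun j => Lform (s j) a)).
      * eapply Clim_ext; [|apply (HQ4 (oadj a) l2)].
        -- intros n. cbv beta. now rewrite HQadj.
        -- now apply (Clim_subseq (fun j => Lform (oadj (s j)) (oadj a))).
    + eapply Clim_unique; [|apply HF].
      eapply Clim_ext; [|apply (Clim_scal half _ _ (Clim_plus _ _ _ _ Hl1 (Clim_conj _ _ Hl2)))].
      intros n. cbv beta. now rewrite bra_symform.
Qed.

End LimitForm.

(** Points of the completion are represented by Cauchy sequences up to [EquivH], so the map picks a
    representative of the Riesz vector and the pairing with it is a limit. *)
Theorem theorem5p8 (D : nat) (HD : (1 <= D)%nat) (S : LatticeSystem D)
  (HS : LS_axioms S) (omega : Obs S -> C) (Hom : ClusteringState S omega) :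
  exists Dhat : (Obs S -> C) -> (nat -> Obs S),
    (* Dhat maps charges into the completion, with  Q(A) = << Dhat Q , A >> *)
    (forall F, IsCharge S omega F ->
       CauchyH S omega (Dhat F) /\
       forall a, filterlim (fun n => bra S omega (Dhat F n) a) eventually (locally (F a))) /\
    (* injective (modulo the identification in the completion) *)
    (forall F G, IsCharge S omega F -> IsCharge S omega G ->
       EquivH S omega (Dhat F) (Dhat G) -> forall a, F a = G a) /\
    (* surjective onto the completion *)
    (forall s, CauchyH S omega s ->
       exists F, IsCharge S omega F /\ EquivH S omega (Dhat F) s).
Proof.
  destruct (cov_decay HD S HS omega Hom) as [q [Hq Hdecay]].
  pose proof (proj1 Hom) as Hst.
  pose proof (bra_psd S HS omega Hst q Hq Hdecay) as HB.
  assert (Hex : forall F, exists s, IsCharge S omega F ->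
    CauchyFor S (bra S omega) s /\ forall a, Clim (fun n => bra S omega (s n) a) (F a)).
  { intros F. destruct (classic (IsCharge S omega F)) as [HF|HF].
    - destruct (charge_bounded S HS omega Hst q Hq Hdecay HD F HF) as [Hlin [K HK]].
      destruct (riesz S _ HB F K Hlin HK) as [s Hs]. exists s. auto.
    (* Arbitrary value on functionals that are not charges. *)
    - exists (fun _ => oone). tauto. }
  apply functional_choice in Hex. destruct Hex as [Dhat HDhat]. exists Dhat.
  split; [|split].
  - intros F HF. destruct (HDhat F HF) as [H1 H2]. split; [exact H1|].
    intros a. apply Clim_filterlim, H2.
  - intros F G HF HG HE a.
    destruct (HDhat F HF) as [_ HF2]. destruct (HDhat G HG) as [_ HG2].
    apply (Clim_unique (fun n => bra S omega (Dhat G n) a)); auto.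
    exact (equiv_pairing S _ HB (Dhat F) (Dhat G) a (F a) HE (HF2 a)).
  - intros s Hs.
    destruct (cauchy_charge S HS omega Hst q Hq Hdecay HD s Hs) as [F [HF HFs]].
    exists F. split; auto. destruct (HDhat F HF) as [H1 H2].
    intros eps He.
    (* The Riesz vector of F and s have the same pairings, so their difference is Cauchy and weakly
       null, hence null. *)
    apply (cauchy_weak_null S _ HB (fun n => osub S (Dhat F n) (s n))); [| |exact He].
    + now apply cauchy_osub.
    + intros a. replace (RtoC 0) with (Cminus (F a) (F a)) by ring.
      eapply Clim_ext; [|apply (Clim_minus _ _ _ _ (H2 a) (HFs a))].
      intros n. cbv beta. now rewrite (form_subl S _ HB).
Qed.
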